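(* Let $\beta\ge(1+\sqrt5)/2$ be an Yrrap number, with $R_\beta$, $\varphi_{-\beta}$, $w_\beta$ and $L$ as in the context. Then $R_\beta$ is a finite set, and, letting $\cdots u'_{-2}u'_{-1}u'_1u'_2\cdots$ be the two-sided infinite word over $R_\beta$ such that $\varphi_{-\beta}^{2n}(w_\beta)$ is a prefix of $u'_1u'_2\cdots$ and $\varphi_{-\beta}^{2n+1}(w_\beta)$ is a suffix of $\cdots u'_{-2}u'_{-1}$ for all $n\ge0$, and setting $z'_k=\sum_{j=1}^kL(u'_j)$ for $k\ge0$ and $z'_k=-\sum_{j=1}^{|k|}L(u'_{-j})$ for $k\le0$, we have \[ \mathbb{Z}_{-\beta}=\{z'_k:k\in\mathbb{Z}\}, \] and the set of distances between consecutive $(-\beta)$-integers is \[ \Delta_{-\beta}=\{z'_{k+1}-z'_k:k\in\mathbb{Z}\}=\{L(w):w\in R_\beta\}. \]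
   Context: For $\beta>1$, $T_{-\beta}:I_\beta\to I_\beta$, $I_\beta=\big[\tfrac{-\beta}{\beta+1},\tfrac{1}{\beta+1}\big)$, $T_{-\beta}(x)=-\beta x-\big\lfloor \tfrac{\beta}{\beta+1}-\beta x\big\rfloor$, and $\mathbb{Z}_{-\beta}=\bigcup_{n\ge0}(-\beta)^nT_{-\beta}^{-n}(0)$. Let $V_\beta=\{T_{-\beta}^n(\tfrac{-\beta}{\beta+1}):n\ge0\}$; $\beta$ is Yrrap if $V_\beta$ is finite. Let $V'_\beta=V_\beta\cup\{0\}$, and for $x\in V'_\beta$ let $r_x=\min\{y\in V'_\beta\cup\{\tfrac1{\beta+1}\}:y>x\}$, $\widehat x=\tfrac{x+r_x}{2}$, $J_x=\{x\}$, $J_{\widehat x}=(x,r_x)$. Alphabet $A_\beta=V'_\beta\cup\{\widehat x:x\in V'_\beta\}$; $\lambda$ is Lebesgue measure; for $v=v_1\cdots v_k\in A_\beta^*$, $L(v)=\sum_{j=1}^k\lambda(J_{v_j})$. For $x\in V'_\beta$ write $(x,r_x)\cap T_{-\beta}^{-1}(V'_\beta)=\{y_1<\cdots<y_m\}$, $y_0=x$, $y_{m+1}=r_x$, $x_i=\lim_{y\to y_{i+1}^-}T_{-\beta}(y)\in V'_\beta$. The anti-morphism $\psi_\beta:A_\beta^*\to A_\beta^*$ ($\psi_\beta(uv)=\psi_\beta(v)\psi_\beta(u)$) is given by $\psi_\beta(x)=T_{-\beta}(x)$, $\psi_\beta(\widehat x)=\widehat{x_m}\,T_{-\beta}(y_m)\cdots\widehat{x_1}\,T_{-\beta}(y_1)\,\widehat{x_0}$.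 Let $\cdots u_{-1}u_0u_1\cdots$ be the two-sided infinite word over $A_\beta$ with $u_0=0$ such that $\psi_\beta^{2n}(\widehat0)$ is a prefix of $u_1u_2\cdots$ and $\psi_\beta^{2n+1}(\widehat0)$ is a suffix of $\cdots u_{-2}u_{-1}$ for all $n\ge0$. For $k\in\mathbb{Z}$ with $u_{2k}=0$ let $s(k)=\min\{j>k:u_{2j}=0\}$. The set of return words of $0$ is $R_\beta=\{u_{2k}u_{2k+1}\cdots u_{2s(k)-1}:k\in\mathbb{Z},\ u_{2k}=0\}$, and $w_\beta=u_0u_1\cdots u_{2s(0)-1}$. For $w\in R_\beta$, the word $\psi_\beta(w0)$ is a factor of $\cdots u_{-1}u_0u_1\cdots$ that can be written uniquely as $w_1\cdots w_m0$ with $w_j\in R_\beta$; set $\varphi_{-\beta}(w)=w_1\cdots w_m$, and extend to an anti-morphism $\varphi_{-\beta}:R_\beta^*\to R_\beta^*$. $L$ is extended to words over $R_\beta$ by viewing them as words over $A_\beta$. *)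

(* Defs.v *)
From HB Require Import structures.
From mathcomp Require Import all_boot all_order all_algebra finmap.
From mathcomp Require Import all_classical all_reals all_analysis.

Set Implicit Arguments.
Unset Strict Implicit.
Unset Printing Implicit Defensive.

Import Order.TTheory GRing.Theory Num.Theory.
Import numFieldNormedType.Exports.

Local Open Scope classical_set_scope.
Local Open Scope ring_scope.

(* The minimum of A; x0 is returned only if A has no minimum. *)
Definition least d (T : porderType d) (x0 : T) (A : set T) : T :=
  xget x0 [set y | A y /\ lbound A y].

Definition word_over (T : eqType) (A : set T) (w : seq T) : Prop :=
  forall a, a \in w -> A a.

Definition antimorphism (T : Type) (f : T -> seq T) (w : seq T) : seq T :=
  flatten (rev (map f w)).

(* For a word indexed by int, the positive part is u_1 u_2 u_3 ... and the
   negative part is ... u_{-3} u_{-2} u_{-1}; neither contains u_0. *)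
Definition prefix_of_positive (T : Type) (w : seq T) (u : int -> T) : Prop :=
  w = [seq u i.+1%:Z | i <- iota 0 (size w)].

Definition suffix_of_negative (T : Type) (w : seq T) (u : int -> T) : Prop :=
  w = rev [seq u (- i.+1%:Z) | i <- iota 0 (size w)].

Section MinusBeta.
Context {R : realType}.
Variable beta : R.

Definition left_end : R := - beta / (beta + 1).

Definition right_end : R := 1 / (beta + 1).

Definition I_beta : set R := `[left_end, right_end[%classic.

(* The formula is used on all of R; its values always lie in I_beta. *)
Definition T_beta (x : R) : R :=
  - beta * x - (Num.floor (beta / (beta + 1) - beta * x))%:~R.

Definition minus_beta_integers : set R :=
  \bigcup_n [set (- beta) ^+ n * x
            | x in [set x | I_beta x /\ iter n T_beta x = 0]].

Definition V_beta : set R := range (fun n => iter n T_beta left_end).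

Definition Yrrap : Prop := finite_set V_beta.

Definition V'_beta : set R := V_beta `|` [set 0].

Definition r_beta (x : R) : R :=
  least 0 [set y | (V'_beta `|` [set right_end]) y /\ x < y].

Definition hat (x : R) : R := (x + r_beta x) / 2.

Definition A_beta : set R := V'_beta `|` (hat @` V'_beta).

(* J_x = {x} and J_{hat x} = (x, r_x) for x in V'_beta; J_v is empty when v is
   not a letter.  No letter is of both kinds, since V'_beta does not meet
   (x, r_x). *)
Definition J_beta (v : R) : set R :=
  [set y | (V'_beta v /\ y = v) \/
           (exists x, [/\ V'_beta x, v = hat x & x < y < r_beta x])].

Definition L_beta (v : seq R) : R :=
  \sum_(a <- v) fine (lebesgue_measure (J_beta a)).

(* y_1 < ... < y_m *)
Definition cuts (x : R) : seq R :=
  sort <=%R (fset_set [set y | x < y < r_beta x /\ V'_beta (T_beta y)]).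

Definition psi_hat (x : R) : seq R :=
  let m := size (cuts x) in
  let y i := nth 0 (x :: rcons (cuts x) (r_beta x)) i in
  let x_ i := lim (T_beta t @[t --> (y i.+1)^'-]) in
  flatten [seq [:: hat (x_ i); T_beta (y i)] | i <- rev (iota 1 m)]
    ++ [:: hat (x_ 0%N)].

(* Only the values at letters matter. *)
Definition psi_letter (v : R) : seq R :=
  if `[< V'_beta v >] then [:: T_beta v]
  else psi_hat (xget 0 [set x | V'_beta x /\ hat x = v]).

Definition psi_beta : seq R -> seq R := antimorphism psi_letter.

Definition is_u_beta (u : int -> R) : Prop :=
  [/\ forall k, A_beta (u k),
      u 0 = 0,
      forall n, prefix_of_positive (iter n.*2 psi_beta [:: hat 0]) u &
      forall n, suffix_of_negative (iter n.*2.+1 psi_beta [:: hat 0]) u].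

Definition u_beta : int -> R := xget (fun=> 0) is_u_beta.

Definition s_beta (k : int) : int :=
  least 0 [set j | k < j /\ u_beta (2 * j) = 0].

(* u_{2k} u_{2k+1} ... u_{2s(k)-1} *)
Definition return_word (k : int) : seq R :=
  [seq u_beta (2 * k + i%:Z) | i <- iota 0 (absz (2 * s_beta k - 2 * k)%R)].

Definition R_beta : set (seq R) :=
  [set return_word k | k in [set k | u_beta (2 * k) = 0]].

Definition w_beta : seq R := return_word 0.

(* Only the values at return words matter. *)
Definition phi_letter (w : seq R) : seq (seq R) :=
  xget [::] [set ws | word_over R_beta ws /\
                      psi_beta (rcons w 0) = rcons (flatten ws) 0].

Definition phi_beta : seq (seq R) -> seq (seq R) := antimorphism phi_letter.

(* The word ... u'_{-2} u'_{-1} u'_1 u'_2 ... has no letter at index 0; that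
   index carries the dummy value [::], which is not a return word. *)
Definition is_u'_beta (u' : int -> seq R) : Prop :=
  [/\ u' 0 = [::],
      forall k, k != 0 -> R_beta (u' k),
      forall n, prefix_of_positive (iter n.*2 phi_beta [:: w_beta]) u' &
      forall n, suffix_of_negative (iter n.*2.+1 phi_beta [:: w_beta]) u'].

Definition z'_beta (u' : int -> seq R) (k : int) : R :=
  if 0 <= k then \sum_(1 <= j < (absz k).+1) L_beta (u' j%:Z)
  else - \sum_(1 <= j < (absz k).+1) L_beta (u' (- j%:Z)).

End MinusBeta.

Definition consecutive_distances (R : realType) (A : set R) : set R :=
  [set d | exists x y, [/\ A x, A y, x < y,
                          forall z, A z -> ~ (x < z < y) & d = y - x]].

(* Main.v *)
Require Import Defs.
From HB Require Import structures.
From mathcomp Require Import all_boot all_order all_algebra finmap.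
From mathcomp Require Import all_classical all_reals all_analysis.
From mathcomp Require Import ring lra zify.

(* Every real y has a type tau(y) = T^n((-beta)^-n y), n large.  Then
   tau(-beta y) = T(tau(y)), the (-beta)-integers are the zeros of tau, and
   {y : tau(y) in V'} = {... < z_{-1} < z_0 = 0 < z_1 < ...} is a discrete set
   between whose consecutive points tau is a translation onto some (x, r_x).
   Recording tau(z_k) at 2k and the letter of (z_k, z_{k+1}) at 2k+1 gives a
   word on which psi acts as multiplication by -beta of the intervals it codes,
   so this word is u.  Return words of 0 are thus the codings of the gaps between
   consecutive (-beta)-integers, and phi acts on them as multiplication by -beta.
   For beta >= (1 + sqrt 5) / 2 every interval contains a preimage of 0 under
   some T^n, because the images of an interval avoiding 0 keep growing; as V' is
   finite, the gaps are bounded and there are finitely many return words. *)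

Set Implicit Arguments.
Unset Strict Implicit.
Unset Printing Implicit Defensive.

Import Order.TTheory GRing.Theory Num.Theory.
Import numFieldNormedType.Exports.

Local Open Scope classical_set_scope.
Local Open Scope ring_scope.

(** * The map [T] and the finite set [V'] *)

Section MinusBetaExpansion.
Context {R : realType}.
Variable beta : R.
Hypothesis beta_gt1 : 1 < beta.

Local Notation T := (T_beta beta).
Local Notation V' := (V'_beta beta).
Local Notation r := (r_beta beta).
Local Notation lend := (left_end beta).
Local Notation rend := (right_end beta).

Let beta_gt0 : 0 < beta. Proof. exact: lt_trans ltr01 beta_gt1. Qed.
Let beta1_neq0 : beta + 1 != 0. Proof. by rewrite gt_eqF // addr_gt0. Qed.

Lemma right_endM : rend * beta = 1 - rend.
Proof. by rewrite /right_end; field. Qed.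

Lemma right_end_bounds : 0 < rend /\ 2 * rend < 1.
Proof.
have e0 : 0 < rend by rewrite divr_gt0 // addr_gt0.
have b1 := beta_gt1; split=> //; have := right_endM; nra.
Qed.

Lemma left_endE : lend = rend - 1.
Proof. by rewrite /left_end /right_end; field. Qed.

Lemma T_betaE x : T x = - beta * x - (Num.floor (1 - rend - beta * x))%:~R.
Proof.
by rewrite /T_beta; congr (_ - (Num.floor (_ - _))%:~R); rewrite /right_end; field.
Qed.

(** The target interval is half-open of length 1, so only one integer can bring [- beta * x] into
    it. *)
Lemma T_beta_def x (n : int) :
  lend <= - beta * x - n%:~R < rend -> T x = - beta * x - n%:~R.
Proof.
move=> h; rewrite T_betaE (@floor_def _ _ n) // intrD.
by move: h; rewrite left_endE; lra.
Qed.

Lemma T_beta_itv x : lend <= T x < rend.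
Proof.
rewrite T_betaE left_endE; have := floor_itv (1 - rend - beta * x).
by rewrite intrD; lra.
Qed.

(** The right-hand side is [- beta * t - n] with the same integer [n] as at [y]; so [T] has slope
    [- beta] as long as this continuation stays in range. *)
Lemma T_beta_shift y t : lend <= T y + beta * (y - t) < rend ->
  T t = T y + beta * (y - t).
Proof.
set n := Num.floor (beta / (beta + 1) - beta * y).
have -> : T y = - beta * y - n%:~R by [].
move: n => n h; have -> : T t = - beta * t - n%:~R by apply: T_beta_def; lra.
lra.
Qed.

Lemma T_beta_linear x : lend <= - beta * x < rend -> T x = - beta * x.
Proof. by move=> h; rewrite (@T_beta_def x 0) ?subr0. Qed.

Lemma T_beta0 : T 0 = 0.
Proof.
have [e0 e1] := right_end_bounds.
by rewrite T_beta_linear mulr0 // left_endE; lra.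
Qed.

Lemma iter_T_beta0 n : iter n T 0 = 0.
Proof. by elim: n => //= n ->; exact: T_beta0. Qed.

(** As the slope is negative and the range is open only at its right end, moving slightly to the
    left of [y] raises the value without leaving the branch. So the limits in [psi_hat] are plain
    values of [T]. *)
Lemma lim_T_beta_left y : lim (T t @[t --> y^'-]) = T y.
Proof.
apply: cvg_lim => //.
have h1 : (fun t => T y + beta * (y - t)) t @[t --> y^'-] --> T y.
  rewrite -[X in _ --> X]addr0 -[X in _ + X](mulr0 beta) -(subrr y).
  apply: cvgD; first exact: cvg_cst.
  apply: cvgM; first exact: cvg_cst.
  apply: cvgB; first exact: cvg_cst.
  exact: cvg_at_left_filter.
apply: cvg_trans h1; apply: near_eq_cvg.
have d0 : 0 < (rend - T y) / beta.
  by rewrite divr_gt0 // subr_gt0; case/andP: (T_beta_itv y).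
near=> t.
apply/esym/T_beta_shift; have := T_beta_itv y.
have ty : t < y by near: t; exact: nbhs_left_lt.
have : y - (rend - T y) / beta < t.
  by near: t; apply: nbhs_left_gt; rewrite ltrBlDr ltrDl.
rewrite ltrBlDr -ltrBlDl ltr_pdivlMr // => h2.
have := mulr_gt0 beta_gt0 (_ : 0 < y - t); nra.
Unshelve. all: by end_near. Qed.

Lemma V'_betaT x : V' x -> V' (T x).
Proof.
move=> [[n _ <-]|->]; first by left; exists n.+1.
by right; rewrite /= T_beta0.
Qed.

Lemma V'_beta0 : V' 0. Proof. by right. Qed.

Lemma V'_beta_left_end : V' lend. Proof. by left; exists 0%N. Qed.

Lemma V'_beta_itv x : V' x -> lend <= x < rend.
Proof.
have [e0 e1] := right_end_bounds.
move=> [[[|n] _ <-]|->]; [|exact: T_beta_itv|]; rewrite /= left_endE; lra.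
Qed.

Hypothesis hY : Yrrap beta.

Lemma finite_V'_beta : finite_set V'.
Proof. by rewrite finite_setU; split; [exact: hY | exact: finite_set1]. Qed.

(** Finiteness of [V'] provides the minimum, so [least] never returns its default 0. *)
Lemma r_betaP x : V' x ->
  [/\ x < r x, V' (r x) \/ r x = rend, r x <= rend &
      forall y, V' y -> x < y -> r x <= y].
Proof.
move=> Vx; have /andP[_ xr] := V'_beta_itv Vx.
pose A := [set y | (V' `|` [set rend]) y /\ x < y].
have finA : finite_set A.
  apply: (@sub_finite_set _ _ (V' `|` [set rend])); first by move=> y [].
  by rewrite finite_setU; split; [exact: finite_V'_beta | exact: finite_set1].
have Ae : A rend by split=> //; right.
have [m [Am lm]] : exists y, A y /\ lbound A y.
  have [s As] := (finite_seqP A).1 finA.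
  have es : rend \in s by move: Ae; rewrite As.
  exists (\big[Order.min/rend]_(y <- s) y); split; last first.
    by move=> y Ay; apply: ge_bigmin_seq => //; move: Ay; rewrite As.
  rewrite big_seq; apply: (big_ind A) => //; last by move=> y; rewrite As.
  by move=> y z Ay Az; rewrite minEle; case: ifP.
have : A (r x) /\ lbound A (r x).
  by apply: (@xgetPex _ 0 [set y | A y /\ lbound A y]); exists m.
move=> [[[Vr|re] xlt] lb]; split=> //; [by left|exact: lb| |by right| |].
- by move=> y Vy xy; apply: lb; split=> //; left.
- by rewrite re.
- by move=> y Vy xy; apply: lb; split=> //; left.
Qed.

End MinusBetaExpansion.

(** * Growth of powers *)

Lemma exprn_unbounded (R : realType) (b c : R) : 1 < b -> exists n, c < b ^+ n.
Proof.
move=> b1.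
(* Bernoulli's inequality. *)
have bern n : n%:R * (b - 1) < b ^+ n.
  elim: n => [|n IH]; first by rewrite mul0r expr0.
  have : 1 <= b ^+ n by rewrite exprn_ege1 // ltW.
  by rewrite exprS -natr1; nra.
exists (Num.trunc (c / (b - 1))).+1; apply: lt_trans (bern _).
by rewrite -ltr_pdivrMr ?subr_gt0 // truncnS_gt.
Qed.

(** One [n] serves both parities: even iterates of the substitutions describe the positive side, odd
    iterates the negative side. *)
Lemma exprn_double_unbounded (R : realType) (b p c : R) : 1 < b -> 0 < c ->
  exists n, p < b ^+ n.*2 * c /\ p < b ^+ n.*2.+1 * c.
Proof.
move=> b1 c0; have [n hn] := exprn_unbounded (p / c) b1.
exists n; rewrite -!ltr_pdivrMr //; split; apply: lt_le_trans hn _;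
  by rewrite ler_weXn2l ?(ltW b1) // -addnn ?leq_addr // -addnS leq_addr.
Qed.

(** * Types of real numbers *)

Section RealTypes.
Context {R : realType}.
Variable beta : R.
Hypothesis beta_gt1 : 1 < beta.

Local Notation T := (T_beta beta).
Local Notation V' := (V'_beta beta).
Local Notation lend := (left_end beta).
Local Notation rend := (right_end beta).

Let beta_gt0 : 0 < beta. Proof. exact: lt_trans ltr01 beta_gt1. Qed.
Let Nbeta_neq0 : - beta != 0. Proof. by rewrite oppr_eq0 gt_eqF. Qed.

(* Extends T^n ((- beta)^-n y) to all reals y: the value stabilises once
   (- beta)^-n y lies within distance right_end of 0.  Smaller n must be excluded:
   for y = left_end, n = 0 gives left_end but n >= 2 gives T left_end. *)
Definition tau (y : R) : R :=
  let n := xget 0%N [set n | `|y| < beta ^+ n * rend] in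
  iter n T ((- beta) ^- n * y).

Lemma norm_lt_exprn (y : R) : exists n, `|y| < beta ^+ n * rend.
Proof.
have [e0 _] := right_end_bounds beta_gt1.
have [n hn] := exprn_unbounded (`|y| / rend) beta_gt1.
by exists n; rewrite -ltr_pdivrMr.
Qed.

Lemma norm_lt_exprnS n (y : R) :
  `|y| < beta ^+ n * rend -> `|y| < beta ^+ n.+1 * rend.
Proof.
have [e0 _] := right_end_bounds beta_gt1.
move=> /lt_trans; apply; rewrite ltr_pM2r // exprS ltr_pMl ?exprn_gt0 //.
Qed.

(** Within distance [right_end] of 0 the map [T] is multiplication by [- beta], so it undoes one
    extra division by [- beta]. *)
Lemma tauE n y : `|y| < beta ^+ n * rend -> tau y = iter n T ((- beta) ^- n * y).
Proof.
have [e0 e1] := right_end_bounds beta_gt1.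
pose f n := iter n T ((- beta) ^- n * y).
have stab m k : `|y| < beta ^+ m * rend -> f (m + k)%N = f m.
  move=> hm; elim: k => [|k IH]; first by rewrite addn0.
  have hk : `|y| < beta ^+ (m + k) * rend.
    by elim: k {IH} => [|k IH]; rewrite ?addn0 // addnS; apply: norm_lt_exprnS.
  rewrite addnS -IH /f iterSr; congr iter.
  have E : - beta * ((- beta) ^- (m + k).+1 * y) = (- beta) ^- (m + k) * y.
    by rewrite exprS invfM mulrA mulrA divff // mul1r.
  rewrite (T_beta_linear beta_gt1) E //.
  have : `|(- beta) ^- (m + k) * y| < rend.
    rewrite normrM normfV normrX normrN (gtr0_norm beta_gt0) mulrC.
    by rewrite ltr_pdivrMr ?exprn_gt0 // mulrC.
  by rewrite left_endE // ltr_norml; lra.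
move=> hn; rewrite /tau.
have := xgetPex 0%N (norm_lt_exprn y); set m := xget _ _ => /= hm.
rewrite -/(f m) -/(f n); have [mn|/ltnW nm] := leqP m n.
  by rewrite -(subnKC mn) stab.
by rewrite -(subnKC nm) stab.
Qed.

Lemma tauM y : tau (- beta * y) = T (tau y).
Proof.
have [n hn] := norm_lt_exprn y.
rewrite (tauE hn) (@tauE n.+1) /=.
  by rewrite exprSr invfM mulrA mulfVK.
rewrite normrM normrN (gtr0_norm beta_gt0) exprS -mulrA.
by rewrite ltr_pM2l.
Qed.

Lemma tau_iter n y : tau ((- beta) ^+ n * y) = iter n T (tau y).
Proof.
by elim: n => [|n IH]; rewrite ?expr0 ?mul1r // exprS -mulrA tauM IH.
Qed.

Lemma tau_id y : lend < y < rend -> tau y = y.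
Proof.
have [e0 e1] := right_end_bounds beta_gt1; have e2 := right_endM beta_gt1.
move=> h; rewrite (@tauE 1) /=.
  by rewrite expr1 (T_beta_linear beta_gt1) mulrA divff // mul1r //; lra.
move: h; rewrite left_endE // expr1 ltr_norml; lra.
Qed.

Lemma tau_left_end : tau lend = T lend.
Proof.
have [e0 e1] := right_end_bounds beta_gt1; have e2 := right_endM beta_gt1.
rewrite (_ : lend = - beta * rend) ?left_endE //; last by lra.
rewrite tauM (@tauE 1) /= ?expr1; last first.
  by rewrite gtr0_norm // ltr_pMl.
congr T.
(* The integer is 1: the value [right_end] is just excluded from the range of [T] and wraps around
   to [left_end = right_end - 1]. *)
rewrite (@T_beta_def _ _ beta_gt1 _ 1) mulrA divff // mul1r.
  by lra.
by rewrite left_endE //; lra.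
Qed.

Lemma tau_right_end : tau rend = lend.
Proof.
have [e0 e1] := right_end_bounds beta_gt1; have e2 := right_endM beta_gt1.
rewrite (@tauE 1) /= ?expr1; last by rewrite gtr0_norm // ltr_pMl.
rewrite (@T_beta_def _ _ beta_gt1 _ 1) mulrA divff // mul1r.
  by rewrite left_endE //; lra.
by rewrite left_endE //; lra.
Qed.

Lemma tau0 : tau 0 = 0.
Proof.
have [e0 e1] := right_end_bounds beta_gt1.
by rewrite tau_id // left_endE //; lra.
Qed.

Lemma tau_V' y : V' y -> V' (tau y).
Proof.
move=> Vy; have /andP[] := V'_beta_itv beta_gt1 Vy.
rewrite le_eqVlt => /orP[/eqP<- _|h1 h2].
  by rewrite tau_left_end; apply: V'_betaT => //; exact: V'_beta_left_end.
by rewrite tau_id // h1.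
Qed.

Lemma minus_beta_integersE : minus_beta_integers beta = [set y | tau y = 0].
Proof.
have [e0 e1] := right_end_bounds beta_gt1.
apply/seteqP; split=> [y [n _ [x [Ix Tx] <-]]|y /= ty].
  rewrite /= tau_iter.
  (* On [I_beta] the type of [x] is [x] itself except at [left_end], where it is one step of [T]
     ahead; this is harmless because [T] fixes 0. *)
  move: Ix; rewrite /I_beta /= in_itv /= => /andP[].
  rewrite le_eqVlt => /orP[/eqP xl _|h1 h2]; last by rewrite tau_id ?h1.
  by rewrite -xl tau_left_end -iterSr iterS xl Tx T_beta0.
have [n hn] := norm_lt_exprn y.
exists n => //; exists ((- beta) ^- n * y); last first.
  by rewrite mulrA divff ?expf_neq0 // mul1r.
split; last by rewrite -tauE.
have : `|(- beta) ^- n * y| < rend.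
  rewrite normrM normfV normrX normrN (gtr0_norm beta_gt0) mulrC.
  by rewrite ltr_pdivrMr ?exprn_gt0 // mulrC.
by rewrite /I_beta /= in_itv /= left_endE // ltr_norml; lra.
Qed.

End RealTypes.

(** * Lengths of letters and their images under [psi] *)

Section Letters.
Context {R : realType}.
Variable beta : R.
Hypothesis beta_gt1 : 1 < beta.
Hypothesis hY : Yrrap beta.

Local Notation T := (T_beta beta).
Local Notation V' := (V'_beta beta).
Local Notation r := (r_beta beta).
Local Notation hat := (hat beta).
Local Notation cuts := (cuts beta).
Local Notation tau := (tau beta).

Let beta_gt0 : 0 < beta. Proof. exact: lt_trans ltr01 beta_gt1. Qed.

Lemma V'_betaF x y : V' x -> V' y -> x < y < r x -> False.
Proof.
move=> Vx Vy /andP[xy yr]; have [_ _ _ h] := r_betaP beta_gt1 hY Vx.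
by have := h _ Vy xy; rewrite leNgt yr.
Qed.

Lemma hat_itv x : V' x -> x < hat x < r x.
Proof.
by move=> Vx; have [xr _ _ _] := r_betaP beta_gt1 hY Vx; rewrite /Defs.hat; lra.
Qed.

Lemma hat_notV' x : V' x -> ~ V' (hat x).
Proof. by move=> Vx Vh; apply: (V'_betaF Vx Vh); exact: hat_itv. Qed.

(** The intervals (x, r x) are disjoint, so their midpoints differ. Together with [hat_notV'] this
    lets [psi_letter] recover [x] from the letter [hat x]. *)
Lemma hat_inj x y : V' x -> V' y -> hat x = hat y -> x = y.
Proof.
wlog xy : x y / x <= y => [hw|] Vx Vy e.
  by have [xy|/ltW xy] := leP x y; [exact: hw|apply/esym/hw].
move: xy; rewrite le_eqVlt => /orP[/eqP //|xy].
have [_ _ _ /(_ _ Vy xy)] := r_betaP beta_gt1 hY Vx.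
by have := hat_itv Vx; have := hat_itv Vy; rewrite e; lra.
Qed.

Lemma letter_length_point v : V' v ->
  fine (lebesgue_measure (J_beta beta v)) = 0.
Proof.
move=> Vv; rewrite (_ : J_beta beta v = [set v]) ?lebesgue_measure_set1 //.
apply/seteqP; split=> y /=; last by move=> ->; left.
by move=> [[]|[x [Vx e _]]] //; case: (hat_notV' Vx); rewrite -e.
Qed.

Lemma letter_length_hat x : V' x ->
  fine (lebesgue_measure (J_beta beta (hat x))) = r x - x.
Proof.
move=> Vx; rewrite (_ : J_beta beta (hat x) = `]x, r x[%classic); last first.
  apply/seteqP; split=> y; rewrite /= in_itv /=; last by right; exists x.
  move=> [[/(hat_notV' Vx)]|[x' [Vx' e]]] //.
  by rewrite (hat_inj Vx Vx' e).
have [xr _ _ _] := r_betaP beta_gt1 hY Vx.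
by rewrite lebesgue_measure_itv /= lte_fin xr -EFinD.
Qed.

Lemma psi_letter_point v : V' v -> psi_letter beta v = [:: T v].
Proof. by move=> Vv; rewrite /psi_letter asboolT. Qed.

Lemma psi_letter_hat x : V' x -> psi_letter beta (hat x) = psi_hat beta x.
Proof.
move=> Vx; rewrite /psi_letter asboolF; last exact: hat_notV'.
congr psi_hat; apply: xget_unique => // y [Vy e]; exact: hat_inj.
Qed.

Lemma antimorphism_cat (U : Type) (f : U -> seq U) v w :
  antimorphism f (v ++ w) = antimorphism f w ++ antimorphism f v.
Proof. by rewrite /antimorphism map_cat rev_cat flatten_cat. Qed.

Lemma antimorphism_cons (U : Type) (f : U -> seq U) a w :
  antimorphism f (a :: w) = antimorphism f w ++ f a.
Proof.
by rewrite -cat1s antimorphism_cat /antimorphism /= cats0.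
Qed.

(** Such a [y] equals - (v + n) / beta with v = T y in the finite set [V'] and an integer n, which
    is bounded because [y] is. *)
Lemma finite_cuts x : V' x ->
  finite_set [set y | x < y < r x /\ V' (T y)].
Proof.
move=> Vx; have [e0 e1] := right_end_bounds beta_gt1.
have lE := left_endE beta_gt1.
(* Since [beta * y] and [T y] have absolute values at most [beta] and 1, |n| is less than beta + 2,
   hence less than [N]. *)
pose N := Num.trunc (beta + 3).
pose I := [set (Posz i - Posz N)%R | i in `I_(N + N).+1].
apply: (@sub_finite_set _ _
   [set - (v + n%:~R) / beta | v in V' & n in I]); last first.
  apply: finite_image2; first exact: finite_V'_beta.
  exact/finite_image/finite_II.
move=> y [/andP[xy yr] VT]; exists (T y) => //.
exists (Num.floor (beta / (beta + 1) - beta * y)); last first.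
  by rewrite /T_beta subrK; field; rewrite gt_eqF.
have [_ _ rr _] := r_betaP beta_gt1 hY Vx.
have /andP[lx _] := V'_beta_itv beta_gt1 Vx.
have b0 := beta_gt0; set n := Num.floor _.
have Tn : T y = - beta * y - n%:~R by [].
have := T_beta_itv beta_gt1 y; rewrite Tn => hT.
have hN : beta + 2 < N%:R.
  by have := truncnS_gt (beta + 3); rewrite -/N -natr1; lra.
have n1 : n%:~R < N%:R :> R.
  have : - beta <= beta * y by nra.
  lra.
have n2 : - N%:R < n%:~R :> R.
  have : beta * y <= beta by nra.
  lra.
move: n1 n2; rewrite !pmulrn -mulrNz !ltr_int => n1 n2.
exists (absz (n + N%:Z)) => /=; lia.
Qed.

Lemma mem_cuts x y : V' x -> y \in cuts x <-> x < y < r x /\ V' (T y).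
Proof.
move=> Vx; rewrite mem_sort in_fset_set; last exact: finite_cuts.
by rewrite in_setE.
Qed.

Lemma sorted_cuts x : sorted <%R (cuts x).
Proof. by rewrite sort_lt_sorted fset_uniq. Qed.

End Letters.

(** * Words coding intervals, and [psi] as multiplication by - beta *)

Section Coding.
Context {R : realType}.
Variable beta : R.
Hypothesis beta_gt1 : 1 < beta.
Hypothesis hY : Yrrap beta.

Local Notation T := (T_beta beta).
Local Notation V' := (V'_beta beta).
Local Notation r := (r_beta beta).
Local Notation lend := (left_end beta).
Local Notation rend := (right_end beta).
Local Notation hat := (hat beta).
Local Notation cuts := (cuts beta).
Local Notation psi := (psi_beta beta).
Local Notation tau := (tau beta).

Let beta_gt0 : 0 < beta. Proof. exact: lt_trans ltr01 beta_gt1. Qed.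

(* A branch of T over (p, q) without preimages of V' cannot cross a discontinuity,
   since T sends discontinuities to left_end. *)
Lemma T_beta_branch p q : p < q -> V' (T p) -> V' (T q) ->
  (forall y, p < y < q -> ~ V' (T y)) ->
  r (T q) - T q = beta * (q - p) /\
  forall y, p < y < q -> T y = T q + beta * (q - y).
Proof.
move=> pq Vp Vq nocut.
have b0 := beta_gt0.
have [e0 e1] := right_end_bounds beta_gt1.
have lE := left_endE beta_gt1.
have /andP[lq qe] := T_beta_itv beta_gt1 q.
have le : T q + beta * (q - p) <= rend.
  (* Otherwise the affine continuation from [q] reaches [right_end] at a point [y] of (p, q); there
     [T] jumps to [left_end], which lies in [V']. *)
  rewrite leNgt; apply/negP => h.
  pose y := q - (rend - T q) / beta.
  have y1 : beta * (q - y) = rend - T q.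
    by rewrite /y; field; rewrite gt_eqF.
  have /nocut : p < y < q.
    rewrite -(ltr_pM2l b0) -[X in _ && X](ltr_pM2l b0); lra.
  apply; rewrite (_ : T y = lend); first exact: V'_beta_left_end.
  have := erefl (T q); rewrite {2}/T_beta; set n := Num.floor _ => Tq.
  have E : - beta * y - (n + 1)%:~R = lend by rewrite intrD lE; lra.
  by rewrite (@T_beta_def _ _ beta_gt1 _ (n + 1)) // E lexx /= lE; lra.
have lin y : p < y <= q -> T y = T q + beta * (q - y).
  move=> /andP[py yq]; apply: T_beta_shift => //.
  have : 0 <= beta * (q - y) by rewrite mulr_ge0 ?subr_ge0 // ltW.
  have : 0 < beta * (y - p) by rewrite mulr_gt0 ?subr_gt0.
  lra.
split; last by move=> y /andP[py yq]; apply: lin; rewrite py ltW.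
have [xr Vr rr rmin] := r_betaP beta_gt1 hY Vq.
have pos : 0 < beta * (q - p) by rewrite mulr_gt0 ?subr_gt0.
have ge : T q + beta * (q - p) <= r (T q).
  (* Otherwise the branch takes the value [r (T q)] strictly between [p] and [q], a forbidden
     preimage of [V']. *)
  rewrite leNgt; apply/negP => h.
  case: Vr => [Vr|re]; last by move: h; rewrite re; lra.
  pose y := q - (r (T q) - T q) / beta.
  have y1 : beta * (q - y) = r (T q) - T q.
    by rewrite /y; field; rewrite gt_eqF.
  have py : p < y < q.
    rewrite -(ltr_pM2l b0) -[X in _ && X](ltr_pM2l b0); lra.
  apply: (nocut y py); rewrite lin; last by case/andP: py => -> /ltW.
  by rewrite y1 subrKC.
apply/eqP; rewrite eq_le; apply/andP; split; last by lra.
(* If the branch ends below [right_end], it extends to [p], so [T p] is a point of [V'] above [T q]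
   and minimality of [r (T q)] applies. *)
case: (ltgtP (T q + beta * (q - p)) rend) le => // h _; last by lra.
have Tp : T p = T q + beta * (q - p) by apply: T_beta_shift => //; lra.
suff : r (T q) <= T p by lra.
by apply: rmin => //; lra.
Qed.

(* (a, b) is an interval between consecutive points of {tau in V'}, and hat x is
   its letter. *)
Definition gap x a b := [/\ V' x, b - a = r x - x, V' (tau a), V' (tau b) &
  forall y, a < y < b -> tau y = y - a + x].

(** The word lists the gaps of (a, b) and the points between them, without the two ends; hence
    joining two codings inserts the type of the common end. *)
Inductive coded : R -> seq R -> R -> Prop :=
| coded_gap x a b : gap x a b -> coded a [:: hat x] b
| coded_cons x a b w c : gap x a b -> coded b w c ->
    coded a (hat x :: tau b :: w) c.

Lemma gap_lt x a b : gap x a b -> a < b.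
Proof.
by move=> [Vx e _ _ _]; have [] := r_betaP beta_gt1 hY Vx; lra.
Qed.

Lemma coded_cat a w b w' c : coded a w b -> coded b w' c ->
  coded a (w ++ tau b :: w') c.
Proof.
elim=> {a w b} [x a b g|x a b w d g _ IH] h /=; first exact: coded_cons.
by apply: coded_cons => //; exact: IH.
Qed.

Lemma coded_ends a w b : coded a w b -> V' (tau a) /\ V' (tau b).
Proof.
by elim=> {a w b} [x a b []|x a b w c [_ _ Va _ _] _ [_ Vc]].
Qed.

(** On the gap [tau] is a translation, so the preimages of [V'] in (x, r x) become, after
    multiplication by - beta, the points with type in [V'] of the image interval; orientation is
    reversed, like the order of letters in [psi_hat]. *)
Lemma coded_psi_hat x a b : gap x a b ->
  coded (- beta * b) (psi_hat beta x) (- beta * a).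
Proof.
move=> [Vx ab Va Vb tE].
have b0 := beta_gt0.
have [xr Vr _ _] := r_betaP beta_gt1 hY Vx.
have VTr : V' (T (r x)).
  (* If [r x] is [right_end], it is not in [V'], but [T] sends it to
     [- beta * right_end = left_end]. *)
  case: Vr => [/(V'_betaT beta_gt1)//|->].
  rewrite (@T_beta_def _ _ beta_gt1 _ 0) subr0.
    rewrite (_ : - beta * rend = lend); first exact: V'_beta_left_end.
    by have := right_endM beta_gt1; rewrite left_endE //; lra.
  have := right_endM beta_gt1; have [e0 e1] := right_end_bounds beta_gt1.
  by rewrite left_endE //; lra.
rewrite /psi_hat; set s := cuts x; set m := size s.
pose y i := nth 0 (x :: rcons s (r x)) i.
have ys i : (0 < i <= m)%N -> x < y i < r x /\ V' (T (y i)).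
  case: i => // i im; apply/(mem_cuts beta_gt1 hY _ Vx).
  by rewrite /y /= nth_rcons (im : (i < size s)%N) mem_nth.
have ym : y m.+1 = r x by rewrite /y /= nth_rcons ltnn eqxx.
have VTy i : (i <= m.+1)%N -> V' (T (y i)).
  case: i => [_|i]; first exact: V'_betaT.
  rewrite ltnS leq_eqVlt => /orP[/eqP ->|im]; first by rewrite ym.
  exact: (ys i.+1 _).2.
have srt : sorted <%R (x :: rcons s (r x)).
  rewrite /= rcons_path.
  have sx : all (fun t => x < t < r x) s.
    by apply/allP => t /(mem_cuts beta_gt1 hY _ Vx)[].
  have := sorted_cuts beta x; rewrite -/s.
  case: {ys ym VTy m y} s sx => [|t s] /=; first by rewrite xr.
  move=> /andP[/andP[-> tr] sx] -> /=.
  by have := mem_last t s; rewrite inE => /orP[/eqP->//|/(allP sx)/andP[]].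
have ymono i j : (i <= m.+1)%N -> (j <= m.+1)%N -> (y i < y j) = (i < j)%N.
  move=> im jm; apply: lt_sorted_ltn_nth => //;
    by rewrite inE /= size_rcons ltnS.
have yx i : (i <= m.+1)%N -> x <= y i <= r x.
  case: i => [_|i]; first by rewrite lexx ltW.
  rewrite ltnS leq_eqVlt => /orP[/eqP ->|im]; first by rewrite ym lexx ltW.
  by have [/andP[/ltW -> /ltW ->]] := ys i.+1 im.
(* The image of the i-th cut; these points decrease with i, from [- beta * a] at 0 to [- beta * b]
   at [m.+1]. *)
pose pt i := - beta * (a + y i - x).
have taupt i : (0 < i <= m)%N -> tau (pt i) = T (y i).
  move=> im; rewrite tauM // tE; last by have [] := ys i im; lra.
  by congr T; lra.
have Vpt i : (i <= m.+1)%N -> V' (tau (pt i)).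
  case: i => [_|i]; first by rewrite tauM // /y /= addrK; exact: V'_betaT.
  rewrite ltnS leq_eqVlt => /orP[/eqP ->|im].
    by rewrite /pt ym (_ : _ - _ = b) ?tauM //; [exact: V'_betaT|lra].
  by rewrite taupt; [exact/VTy/leqW|].
have nocut i t : (i <= m)%N -> y i < t < y i.+1 -> ~ V' (T t).
  move=> im ty Vt.
  have : t \in s.
    apply/(mem_cuts beta_gt1 hY _ Vx); split=> //.
    have := yx i (leqW im); have := yx i.+1 im; lra.
  move=> /(nthP 0)[j jm tj].
  have yj : y j.+1 = t by rewrite /y /= nth_rcons jm.
  move: ty; rewrite -yj => /andP[].
  rewrite (ymono i j.+1 (leqW im) (leqW jm)) (ymono j.+1 i.+1 (leqW jm) im) !ltnS.
  by move=> /leq_ltn_trans h /h; rewrite ltnn.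
have gapk i : (i <= m)%N -> gap (T (y i.+1)) (pt i.+1) (pt i).
  move=> im.
  have yi : y i < y i.+1 by rewrite ymono // leqW.
  have [len lin] := T_beta_branch yi (VTy i (leqW im)) (VTy i.+1 im)
    (fun t => @nocut i t im).
  split; [exact: VTy|by rewrite /pt len; lra|exact: Vpt|exact/Vpt/leqW|].
  move=> z /andP[z1 z2].
  have zE : z = - beta * (- z / beta) by field; rewrite gt_eqF.
  have h1 : y i - x + a < - z / beta.
    by rewrite ltr_pdivlMr //; move: z2; rewrite /pt; lra.
  have h2 : - z / beta < y i.+1 - x + a.
    by rewrite ltr_pdivrMr //; move: z1; rewrite /pt; lra.
  have := yx i (leqW im); have := yx i.+1 im => k1 k2.
  rewrite {1}zE tauM // tE; last by lra.
  by rewrite lin; [rewrite {2}zE /pt|]; lra.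
have E : flatten [seq [:: hat (lim (T t @[t --> (y i.+1)^'-])); T (y i)]
                  | i <- rev (iota 1 m)]
    ++ [:: hat (lim (T t @[t --> (y 1%N)^'-]))] =
  flatten [seq [:: hat (T (y i.+1)); T (y i)] | i <- rev (iota 1 m)]
    ++ [:: hat (T (y 1%N))].
  congr (flatten _ ++ [:: hat _]); last exact: lim_T_beta_left.
  by apply: eq_map => i; rewrite lim_T_beta_left.
rewrite E.
have -> : - beta * b = pt m.+1 by rewrite /pt ym; congr (_ * _); lra.
have -> : - beta * a = pt 0%N by rewrite /pt /y /= addrK.
(* Induction on k for the interval from [pt k.+1] to [pt 0]: the new leftmost gap supplies the first
   two letters. *)
elim: {-2}m (leqnn m) => [_|k IH km]; first exact/coded_gap/gapk.
rewrite (_ : iota 1 k.+1 = iota 1 k ++ [:: k.+1]); last first.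
  by rewrite -{1}(addn1 k) iotaD add1n.
rewrite rev_cat /= -(taupt k.+1) //.
by apply: coded_cons; [exact: gapk|exact/IH/ltnW].
Qed.

Lemma coded_psi a w b : coded a w b -> coded (- beta * b) (psi w) (- beta * a).
Proof.
elim=> {a w b} [x a b g|x a b w c g bc IH].
  have [Vx _ _ _ _] := g.
  rewrite /psi_beta /antimorphism /= cats0 psi_letter_hat //.
  exact: coded_psi_hat.
have [Vx _ _ Vb _] := g.
rewrite /psi_beta !antimorphism_cons psi_letter_hat // psi_letter_point //.
rewrite -catA /= -tauM //; apply: coded_cat => //; exact: coded_psi_hat.
Qed.

Lemma coded_hat0 : coded 0 [:: hat 0] (r 0).
Proof.
have V0 := V'_beta0 beta.
have [r0 Vr re _] := r_betaP beta_gt1 hY V0.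
have [e0 e1] := right_end_bounds beta_gt1.
apply: coded_gap; split; rewrite ?tau0 //.
  case: Vr => [|->]; first exact: tau_V'.
  (* The end [right_end] has type [left_end], not itself. *)
  by rewrite tau_right_end //; exact: V'_beta_left_end.
by move=> y yr; rewrite tau_id // ?subr0 ?addr0 // left_endE //; lra.
Qed.

(** The end 0 is fixed by multiplication by - beta, which swaps its two sides at each application of
    [psi]. *)
Lemma coded_iter_psi n : 
  coded 0 (iter n.*2 psi [:: hat 0]) (beta ^+ n.*2 * r 0) /\
  coded (- beta ^+ n.*2.+1 * r 0) (iter n.*2.+1 psi [:: hat 0]) 0.
Proof.
suff h : coded 0 (iter n.*2 psi [:: hat 0]) (beta ^+ n.*2 * r 0).
  split=> //; have := coded_psi h.
  by rewrite mulr0 mulrA mulNr -exprS.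
elim: n => [|n IH]; first by rewrite expr0 mul1r; exact: coded_hat0.
have := coded_psi (coded_psi IH).
by rewrite !mulr0 doubleS !exprS !mulrA mulrNN.
Qed.

(** Inside a gap [tau] takes values in (x, r x), which misses [V']; so [p] can only be the left end
    of a gap of the coding. *)
Lemma coded_next a w b p : coded a w b -> a <= p < b -> V' (tau p) ->
  exists x q, gap x p q.
Proof.
have aux x c d : gap x c d -> V' (tau p) -> c <= p < d -> gap x p d.
  move=> g Vp /andP[]; rewrite le_eqVlt => /orP[/eqP <- //|cp pd].
  have [Vx e _ _ tE] := g; have := tE p; rewrite cp pd => /(_ isT) E.
  by case: (V'_betaF beta_gt1 hY Vx Vp); rewrite E; lra.
move=> h; elim: h => {a w b} [x a b g|x a b w c g _ IH] /andP[ap pc] Vp.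
  by exists x, b; apply: aux g _ _ => //; rewrite ap.
have [pb|bp] := ltP p b; last by apply: IH => //; rewrite bp.
by exists x, b; apply: aux g _ _ => //; rewrite ap.
Qed.

Lemma coded_prev a w b p : coded a w b -> a < p <= b -> V' (tau p) ->
  exists x q, gap x q p.
Proof.
have aux x c d : gap x c d -> V' (tau p) -> c < p <= d -> gap x c p.
  move=> g Vp /andP[cp]; rewrite le_eqVlt => /orP[/eqP -> //|pd].
  have [Vx e _ _ tE] := g; have := tE p; rewrite cp pd => /(_ isT) E.
  by case: (V'_betaF beta_gt1 hY Vx Vp); rewrite E; lra.
move=> h; elim: h => {a w b} [x a b g|x a b w c g _ IH] /andP[ap pc] Vp.
  by exists x, a; apply: aux g _ _ => //; rewrite ap.
have [pb|bp] := leP p b; last by apply: IH => //; rewrite bp.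
by exists x, a; apply: aux g _ _ => //; rewrite ap.
Qed.

Lemma coded_cover p : exists n,
  - beta ^+ n.*2.+1 * r 0 < p /\ p < beta ^+ n.*2 * r 0.
Proof.
have [r0 _ _ _] := r_betaP beta_gt1 hY (V'_beta0 beta).
have [n [h1 h2]] := exprn_double_unbounded `|p| beta_gt1 r0; exists n; split.
  by move: h2; rewrite mulNr ltr_norml => /andP[].
by move: h1; rewrite ltr_norml => /andP[].
Qed.

Lemma gap_next p : V' (tau p) -> exists x q, gap x p q.
Proof.
move=> Vp; have [n [h1 h2]] := coded_cover p.
have [c1 c2] := coded_iter_psi n.
have [p0|p0] := leP 0 p.
  by apply: (coded_next c1) => //; rewrite p0.
by apply: (coded_next c2) => //; rewrite ltW.
Qed.

Lemma gap_prev p : V' (tau p) -> exists x q, gap x q p.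
Proof.
move=> Vp; have [n [h1 h2]] := coded_cover p.
have [c1 c2] := coded_iter_psi n.
have [p0|p0] := ltP 0 p.
  by apply: (coded_prev c1) => //; rewrite p0 ltW.
by apply: (coded_prev c2) => //; rewrite h1.
Qed.

End Coding.

(** * Preimages of 0 are dense when beta^2 is at least beta + 1 *)

Section Density.
Context {R : realType}.
Variable beta : R.
Hypothesis beta_gt1 : 1 < beta.

Local Notation T := (T_beta beta).
Local Notation lend := (left_end beta).
Local Notation rend := (right_end beta).

Hypothesis beta_golden : beta + 1 <= beta ^+ 2.

Definition avoids_zero a b := [/\ lend <= a, a < b, b <= rend &
  forall n x, a < x < b -> iter n T x <> 0].

Lemma avoids_zero_image k a b a' b' : avoids_zero a b ->
  lend <= a' -> a' < b' -> b' <= rend ->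
  (forall x', a' < x' < b' -> exists2 x, a < x < b & iter k T x = x') ->
  avoids_zero a' b'.
Proof.
move=> [la ab br av] la' ab' br' im; split=> // n x' /im[x xab <-].
by rewrite -iterD; exact: av.
Qed.

(* Along a discontinuity y, the part (y, b) is blown up twice and the part (a, y)
   once; the worst case is y - a = beta (b - y).  If beta^2 = beta + 1 there is no
   growth in that case, but then T (T y) = T left_end = 0. *)
Lemma avoids_zero_grow a b : avoids_zero a b -> exists a' b',
  avoids_zero a' b' /\
  (if beta ^+ 2 == beta + 1 then beta else beta ^+ 2 / (beta + 1)) * (b - a)
    <= b' - a'.
Proof.
move=> av; have [la ab br nz] := av.
have b1 := beta_gt1; have bg := beta_golden.
have b0 : 0 < beta by lra.
have [e0 e1] := right_end_bounds beta_gt1.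
have eM := right_endM beta_gt1.
have lE := left_endE beta_gt1.
have cb : (if beta ^+ 2 == beta + 1 then beta else beta ^+ 2 / (beta + 1)) <= beta.
  by case: ifP => // _; rewrite ler_pdivrMr; nra.
move: cb; set c0 := (if _ then _ else _).
have [c cdef] : exists c, c = c0 by exists c0.
rewrite -cdef => cb.
(* The integer subtracted by [T] at [b] and just to its left. Either all of (a, b) lies on this
   branch, or the next branch [n = j + 1] begins at a discontinuity [y] inside. *)
pose j := Num.floor (1 - rend - beta * b).
have /andP[j1 j2] := floor_itv (1 - rend - beta * b); rewrite -/j in j1 j2.
rewrite intrD in j2.
have Tx x n : lend <= - beta * x - n%:~R < rend -> T x = - beta * x - n%:~R.
  exact: T_beta_def.
have ba : 0 < beta * (b - a) by rewrite mulr_gt0 // subr_gt0.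
have cba : c * (b - a) <= beta * (b - a) by rewrite ler_pM2r // subr_gt0.
have [cont|disc] := leP (1 - rend - beta * a) (j%:~R + 1).
  exists (- beta * b - j%:~R), (- beta * a - j%:~R); split; last by lra.
  apply: (avoids_zero_image (k := 1) av); [lra|lra|lra|].
  move=> x' hx'; exists ((- x' - j%:~R) / beta).
    by rewrite ltr_pdivlMr // ltr_pdivrMr //; lra.
  have E : - beta * ((- x' - j%:~R) / beta) - j%:~R = x'.
    by field; rewrite gt_eqF.
  by rewrite /= (Tx _ j) E //; lra.
pose n := j + 1.
have nE : n%:~R = j%:~R + 1 :> R by rewrite intrD.
pose y := (1 - rend - n%:~R) / beta.
have yE : beta * y = 1 - rend - n%:~R by rewrite /y; field; rewrite gt_eqF.
have ya : a < y by rewrite -(ltr_pM2l b0); lra.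
have yb : y < b by rewrite -(ltr_pM2l b0); lra.
have Ty : T y = lend by rewrite (Tx _ n); lra.
(* The zero - j / beta of the branch at [b] lies right of [y], so it is not below [b]; likewise the
   zero - n / beta of the other branch lies left of [y], so it is not above [a]. *)
have bz : b <= - j%:~R / beta.
  rewrite leNgt; apply/negP => h; apply: (nz 1%N (- j%:~R / beta)) => /=.
    by rewrite h andbT ltr_pdivlMr //; lra.
  have E : - beta * (- j%:~R / beta) - j%:~R = 0 by field; rewrite gt_eqF.
  by rewrite (Tx _ j) E //; lra.
have az : - n%:~R / beta <= a.
  rewrite leNgt; apply/negP => h; apply: (nz 1%N (- n%:~R / beta)) => /=.
    by rewrite h /= ltr_pdivrMr //; lra.
  have E : - beta * (- n%:~R / beta) - n%:~R = 0 by field; rewrite gt_eqF.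
  by rewrite (Tx _ n) E //; lra.
move: bz az; rewrite ler_pdivlMr // ler_pdivrMr // => bz az.
have ngold : (beta ^+ 2 == beta + 1) = false.
  apply/negP => /eqP gold; apply: (nz 2%N y) => /=; first by rewrite ya.
  rewrite Ty lE (Tx _ 1); nra.
have cE : c * (beta + 1) = beta ^+ 2.
  by rewrite cdef /c0 ngold; field; rewrite gt_eqF //; lra.
(* [T] maps (y, b) to an interval right of 0 ending at [right_end], where [T] is linear, so the
   second image starts at [left_end]. If this image is too short, then beta * (y - a) exceeds c * (b
   - a), because c * (beta + 1) = beta^2. *)
have [big|small] := leP (c * (b - a)) (beta ^+ 2 * (b - y)).
  exists lend, (lend + beta ^+ 2 * (b - y)); split; last by lra.
  have p2 : 0 < beta ^+ 2 * (b - y) by rewrite mulr_gt0 ?exprn_gt0 // subr_gt0.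
  have p3 : lend + beta ^+ 2 * (b - y) <= rend by nra.
  apply: (avoids_zero_image (k := 2) av); [lra|lra|lra|].
  move=> x' /andP[h1 h2].
  have v1 : beta * (x' / beta) = x' by field; rewrite gt_eqF.
  have v2 : - rend < x' / beta by rewrite -(ltr_pM2l b0) v1; lra.
  have v3 : x' / beta < - rend + beta * (b - y).
    by rewrite -(ltr_pM2l b0) v1; lra.
  exists ((x' / beta - j%:~R) / beta).
    by rewrite ltr_pdivlMr // ltr_pdivrMr //; lra.
  have E : - beta * ((x' / beta - j%:~R) / beta) - j%:~R = - (x' / beta).
    by field; rewrite gt_eqF.
  rewrite /= (Tx ((x' / beta - j%:~R) / beta) j) E; last by lra.
  by rewrite (T_beta_linear beta_gt1) mulrNN v1 //; lra.
have p1 : 0 < beta * (y - a) by rewrite mulr_gt0 // subr_gt0.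
exists lend, (lend + beta * (y - a)); split; last first.
  rewrite addrAC subrr add0r.
  have : (beta + 1) * (c * (b - a)) = beta ^+ 2 * (b - a).
    by rewrite -cE; ring.
  nra.
apply: (avoids_zero_image (k := 1) av); [lra|lra|lra|].
move=> x' /andP[h1 h2]; exists ((- x' - n%:~R) / beta).
  by rewrite ltr_pdivlMr // ltr_pdivrMr //; lra.
have E : - beta * ((- x' - n%:~R) / beta) - n%:~R = x'.
  by field; rewrite gt_eqF.
by rewrite /= (Tx _ n) E //; lra.
Qed.

(** An interval avoiding the preimages of 0 would have such intervals of geometrically growing
    length inside one of length 1. *)
Lemma zero_dense a b : lend <= a -> a < b -> b <= rend ->
  exists n x, a < x < b /\ iter n T x = 0.
Proof.
move=> la ab br; apply: contrapT => hno.
have av : avoids_zero a b.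
  by split=> // n x xab Tn; apply: hno; exists n, x.
have b1 := beta_gt1; have bg := beta_golden.
set c := if beta ^+ 2 == beta + 1 then beta else beta ^+ 2 / (beta + 1).
have c1 : 1 < c.
  rewrite /c; case: eqP => // /eqP ne.
  by rewrite ltr_pdivlMr ?mul1r; [rewrite lt_neqAle eq_sym ne|lra].
have big n : exists a' b', avoids_zero a' b' /\ c ^+ n * (b - a) <= b' - a'.
  elim: n => [|n [a' [b' [av' h]]]]; first by exists a, b; rewrite expr0 mul1r.
  have [a2 [b2 [av2 h2]]] := avoids_zero_grow av'.
  exists a2, b2; split=> //; apply: le_trans h2.
  by rewrite -/c exprS -mulrA ler_pM2l //; lra.
have [n hn] := exprn_unbounded (b - a)^-1 c1.
have [a' [b' [[la' _ br' _]]]] := big n.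
have := left_endE beta_gt1.
have : 1 < c ^+ n * (b - a).
  by rewrite -ltr_pdivrMr ?subr_gt0 // mul1r.
lra.
Qed.

End Density.

(** * Two-sided chains and increasing sequences indexed by the integers *)

Lemma bi_infinite_chain (T : Type) (D : set T) (P : T -> T -> Prop) (x0 : T) :
  D x0 -> (forall x, D x -> exists y, D y /\ P x y) ->
  (forall x, D x -> exists y, D y /\ P y x) ->
  exists z : int -> T, z 0 = x0 /\ forall k, D (z k) /\ P (z k) (z (k + 1)).
Proof.
move=> D0 nxt prv.
have /choice[f fP] x : exists y, D x -> D y /\ P x y.
  by have [/nxt[y h]|nD] := pselect (D x); [exists y|exists x].
have /choice[g gP] x : exists y, D x -> D y /\ P y x.
  by have [/prv[y h]|nD] := pselect (D x); [exists y|exists x].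
have Df n : D (iter n f x0) by elim: n => //= n /fP[].
have Dg n : D (iter n g x0) by elim: n => //= n /gP[].
(* Successors are iterated to the right and predecessors to the left; [Negz n] stands for - (n + 1),
   whence [n.+1] iterations. *)
exists (fun k => match k with Posz n => iter n f x0 | Negz n => iter n.+1 g x0 end).
split=> // -[n|n].
  by rewrite -PoszD addn1; split=> //; have [] := fP _ (Df n).
split; first exact: Dg n.+1.
case: n => [|n]; first by have [] := gP _ (Dg 0%N).
rewrite (_ : Negz n.+1 + 1 = Negz n); last by rewrite !NegzE; lia.
by have [] := gP _ (Dg n.+1).
Qed.

Section IncreasingSequences.
Local Open Scope order_scope.
Context {d : Order.disp_t} {T : orderType d}.
Variable f : int -> T.
Hypothesis f_incr : forall k : int, f k < f (k + 1)%R.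

Lemma int_increasing_lt i j : (f i < f j) = (i < j)%R.
Proof.
have lt k (n : nat) : f k < f (k + n.+1%:Z)%R.
  elim: n => [|n IH]; first exact: f_incr.
  apply: lt_trans IH _; have := f_incr (k + n.+1%:Z)%R.
  by rewrite -addrA (_ : (n.+1%:Z + 1)%R = n.+2%:Z) //; lia.
have lt' k l : (k < l)%R -> f k < f l.
  by move=> kl; rewrite (_ : l = k + (absz (l - k)).-1.+1%:Z)%R //; lia.
have [/lt'//|/lt' h|->] := ltgtP i j; last by rewrite ltxx.
by apply/negbTE; rewrite -leNgt ltW.
Qed.

Lemma int_increasing_le i j : (f i <= f j) = (i <= j)%R.
Proof. by rewrite !leNgt int_increasing_lt. Qed.

Lemma int_increasing_inj : injective f.
Proof.
by move=> i j e; apply/eqP; rewrite eq_le -!int_increasing_le e lexx.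
Qed.

Lemma int_increasing_between p : (exists n : nat, f (- n%:Z)%R <= p < f n%:Z) ->
  exists k : int, f k <= p < f (k + 1)%R.
Proof.
move=> [n /andP[h1 h2]].
have : exists m : nat, p < f (- n%:Z + m%:Z)%R.
  by exists (n + n)%N; rewrite (_ : (- _ + _)%R = n%:Z) //; lia.
move=> ex; case: (ex_minnP ex) => -[|m] pm mmin.
  by move: pm; rewrite addr0 ltNge h1.
exists (- n%:Z + m%:Z)%R; apply/andP; split; last first.
  by rewrite -addrA -PoszD addn1.
by rewrite leNgt; apply/negP => /mmin; rewrite ltnn.
Qed.

End IncreasingSequences.

(** * Factors of two-sided infinite words *)

Section Subwords.
Variable T : Type.
Implicit Types u v : int -> T.

Definition subword u (i : int) (n : nat) : seq T :=
  [seq u (i + k%:Z) | k <- iota 0 n].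

Lemma size_subword u i n : size (subword u i n) = n.
Proof. by rewrite size_map size_iota. Qed.

Lemma subwordS u i n : subword u i n.+1 = u i :: subword u (i + 1) n.
Proof.
rewrite /subword /= addr0 (iotaDl 1 0) -map_comp; congr cons.
by apply: eq_map => k /=; rewrite -addrA.
Qed.

Lemma subword_cat u i m n :
  subword u i (m + n) = subword u i m ++ subword u (i + m%:Z) n.
Proof.
elim: m i => [|m IH] i; first by rewrite addr0.
by rewrite addSn !subwordS IH -addrA.
Qed.

Lemma subword_prefix u n : prefix_of_positive (subword u 1 n) u.
Proof. by rewrite /prefix_of_positive size_subword; apply: eq_map => k. Qed.

Lemma subword_suffix u n : suffix_of_negative (subword u (- n%:Z) n) u.
Proof.
rewrite /suffix_of_negative size_subword; elim: n => // n IH.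
rewrite -[in RHS]addn1 iotaD map_cat rev_cat -IH subwordS add0n /=.
by congr (_ :: subword _ _ _); lia.
Qed.

Lemma nth_prefix u w x k : prefix_of_positive w u -> (k < size w)%N ->
  nth x w k = u k.+1%:Z.
Proof.
by move=> {2}-> kw; rewrite (nth_map 0%N) ?size_iota // nth_iota.
Qed.

Lemma nth_suffix u w x k : suffix_of_negative w u -> (k < size w)%N ->
  nth x (rev w) k = u (- k.+1%:Z).
Proof.
by move=> {2}-> kw; rewrite revK (nth_map 0%N) ?size_iota // nth_iota.
Qed.

(** Each nonzero index falls into a sufficiently long prefix or suffix; index 0 is covered by
    neither and needs its own hypothesis. *)
Lemma bi_infinite_unique u v (W : nat -> seq T) :
  u 0 = v 0 -> (forall m, exists n, (m < size (W n.*2))%N) ->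
  (forall m, exists n, (m < size (W n.*2.+1))%N) ->
  (forall n, prefix_of_positive (W n.*2) u) ->
  (forall n, suffix_of_negative (W n.*2.+1) u) ->
  (forall n, prefix_of_positive (W n.*2) v) ->
  (forall n, suffix_of_negative (W n.*2.+1) v) -> u = v.
Proof.
move=> e0 big bigN pu su pv sv; apply/funext => -[[//|k]|k].
  have [n hn] := big k.
  by rewrite -(nth_prefix (u 0) (pu n) hn) (nth_prefix (u 0) (pv n) hn).
have [n hn] := bigN k; rewrite NegzE.
by rewrite -(nth_suffix (u 0) (su n) hn) (nth_suffix (u 0) (sv n) hn).
Qed.

End Subwords.

(** * Enumeration of the points with type in [V'], and the word [u] *)

Section Enumeration.
Context {R : realType}.
Variable beta : R.
Hypothesis beta_gt1 : 1 < beta.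
Hypothesis hY : Yrrap beta.

Local Notation T := (T_beta beta).
Local Notation V' := (V'_beta beta).
Local Notation r := (r_beta beta).
Local Notation hat := (hat beta).
Local Notation psi := (psi_beta beta).
Local Notation tau := (tau beta).
Local Notation gap := (gap beta).
Local Notation coded := (coded beta).

(** At a point common to both intervals the two formulas for [tau] force x = x'; the length then
    fixes the right end. *)
Lemma gap_unique x x' a b b' : gap x a b -> gap x' a b' -> x = x' /\ b = b'.
Proof.
move=> g g'; have ab := gap_lt beta_gt1 hY g; have ab' := gap_lt beta_gt1 hY g'.
have [Vx e _ _ tE] := g; have [Vx' e' _ _ tE'] := g'.
have [y [y1 y2]] : exists y, a < y < b /\ a < y < b'.
  have m : a < Num.min b b' by rewrite lt_min ab.
  exists ((a + Num.min b b') / 2).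
  have : Num.min b b' <= b by rewrite ge_min lexx.
  have : Num.min b b' <= b' by rewrite ge_min lexx orbT.
  lra.
have xx : x = x' by have := tE _ y1; rewrite tE' //; lra.
by split=> //; move: e e'; rewrite -xx; lra.
Qed.

Lemma gap_le1 x a b : gap x a b -> b - a <= 1.
Proof.
move=> [Vx -> _ _ _].
have [_ _ rr _] := r_betaP beta_gt1 hY Vx.
have /andP[lx _] := V'_beta_itv beta_gt1 Vx.
have lE := left_endE beta_gt1; lra.
Qed.

(** Long intervals need long words; this makes the iterates of [psi] exhaust all indices. *)
Lemma coded_size a w b : coded a w b -> b - a <= (size w)%:R.
Proof.
elim=> {a w b} [x a b /gap_le1 //|x a b w c /gap_le1 h _ IH] /=.
by rewrite -!natr1; lra.
Qed.

(** Only finitely many gap lengths occur as [V'] is finite; the bound keeps the enumeration from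
    accumulating. *)
Lemma min_gap : exists2 d, 0 < d & forall x a b, gap x a b -> d <= b - a.
Proof.
have [s Vs] := (finite_seqP _).1 (finite_V'_beta hY).
exists (\big[Order.min/1]_(x <- s) (r x - x)).
  rewrite big_seq; apply: (big_ind (fun d => 0 < d)) => //.
    by move=> x y x0 y0; rewrite lt_min x0.
  move=> x xs; have Vx : V' x by rewrite Vs.
  by have [xr _ _ _] := r_betaP beta_gt1 hY Vx; rewrite subr_gt0.
move=> x a b [Vx -> _ _ _]; apply: ge_bigmin_seq => //.
by move: Vx; rewrite Vs.
Qed.

Lemma gap_chain : exists (z : int -> R) (e : int -> R),
  z 0 = 0 /\ forall k, gap (e k) (z k) (z (k + 1)).
Proof.
have [|||z [z0 zP]] := @bi_infinite_chain R [set p | V' (tau p)]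
  (fun p q => exists x, gap x p q) 0 _ _ _.
- by rewrite /= tau0 //; exact: V'_beta0.
- move=> p /(gap_next beta_gt1 hY)[x [q g]].
  by exists q; split; [have [] := g|exists x].
- move=> p /(gap_prev beta_gt1 hY)[x [q g]].
  by exists q; split; [have [] := g|exists x].
have /choice[e eP] k : exists x, gap x (z k) (z (k + 1)) by have [] := zP k.
by exists z, e.
Qed.

Variables z e : int -> R.
Hypothesis z0 : z 0 = 0.
Hypothesis zgap : forall k, gap (e k) (z k) (z (k + 1)).

(** Integer division rounds so that remainders are 0 or 1; hence for negative indices too, 2k is the
    k-th point and 2k + 1 the gap to its right. *)
Definition coding (k : int) : R :=
  if (k %% 2)%Z == 0 then tau (z (k %/ 2)%Z) else hat (e (k %/ 2)%Z).

Lemma coding_even k : coding (2 * k) = tau (z k).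
Proof. by rewrite /coding mulrC modzMl eqxx mulzK. Qed.

Lemma coding_odd k : coding (2 * k + 1) = hat (e k).
Proof.
rewrite /coding mulrC modzMDl /=.
by rewrite divzMDl // addr0.
Qed.

Lemma chain_V' k : V' (tau (z k)).
Proof. by have [] := zgap k. Qed.

Lemma chain_e k : V' (e k).
Proof. by have [] := zgap k. Qed.

Lemma chain_incr k : z k < z (k + 1).
Proof. exact: (gap_lt beta_gt1 hY (zgap k)). Qed.

Lemma chain_unbounded p : exists n : nat, z (- n%:Z) <= p < z n%:Z.
Proof.
have [d d0 dP] := min_gap.
have up (n : nat) : n%:R * d <= z n%:Z.
  elim: n => [|n IH]; first by rewrite mul0r z0.
  have := dP _ _ _ (zgap n%:Z).
  by rewrite -natr1 (_ : n%:Z + 1 = n.+1%:Z); [lra|lia].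
have down (n : nat) : z (- n%:Z) <= - (n%:R * d).
  elim: n => [|n IH]; first by rewrite mul0r oppr0 z0.
  have := dP _ _ _ (zgap (- n.+1%:Z)).
  rewrite -natr1 (_ : - n.+1%:Z + 1 = - n%:Z); last by lia.
  lra.
exists (Num.trunc (`|p| / d)).+1; set n := _.+1.
have : `|p| < n%:R * d by rewrite -ltr_pdivrMr // truncnS_gt.
rewrite ltr_norml; have := up n; have := down n; lra.
Qed.

Lemma chain_surj p : V' (tau p) -> exists k, p = z k.
Proof.
move=> Vp; have [k /andP[]] := int_increasing_between (chain_unbounded p).
rewrite le_eqVlt => /orP[/eqP <- _|h1 h2]; first by exists k.
have [Vx e' _ _ tE] := zgap k.
have E := tE p _; case: (V'_betaF beta_gt1 hY Vx Vp).
by rewrite E ?h1 //; lra.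
Qed.

(** The left end determines the successive gaps, hence the whole coding. *)
Lemma coded_subword a w b i : coded a w b -> a = z i ->
  exists n : nat, b = z (i + n.+1%:Z) /\ w = subword coding (2 * i + 1) n.*2.+1.
Proof.
move=> h; elim: h i => {a w b} [x a b g|x a b w c g _ IH] i ai.
  have [-> ->] : x = e i /\ b = z (i + 1).
    by rewrite ai in g; exact: gap_unique g (zgap i).
  by exists 0%N; rewrite subwordS coding_odd.
have [xe bz] : x = e i /\ b = z (i + 1).
  by rewrite ai in g; exact: gap_unique g (zgap i).
have [n [-> ->]] := IH _ bz; exists n.+1; split; first by congr z; lia.
rewrite doubleS (subwordS _ _ n.*2.+2) (subwordS _ _ n.*2.+1) coding_odd xe bz.
rewrite (_ : 2 * i + 1 + 1 = 2 * (i + 1)) ?coding_even; last by lia.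
by [].
Qed.

Lemma is_u_beta_coding : is_u_beta beta coding.
Proof.
split.
- move=> k; rewrite /coding; case: ifP => _; first by left; exact: chain_V'.
  by right; exists (e (k %/ 2)%Z) => //; exact: chain_e.
- by rewrite -[0](mulr0 2) coding_even z0 tau0.
- move=> n; have [h _] := coded_iter_psi beta_gt1 hY n.
  have [m [_ ->]] := coded_subword h (esym z0).
  exact: subword_prefix.
- move=> n; have [_ h] := coded_iter_psi beta_gt1 hY n.
  have [i zi] := chain_surj (coded_ends h).1.
  have [m [zm ->]] := coded_subword h zi.
  move: zm; rewrite -[LHS]z0 => /(int_increasing_inj chain_incr) im.
  (* The interval ends at [z 0], so i = - (m + 1): the word runs from index 2 * i + 1 to - 1,
     leaving out the letter at 0. *)
  rewrite (_ : 2 * i + 1 = - m.*2.+1%:Z); first exact: subword_suffix.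
  lia.
Qed.

Lemma u_beta_coding : u_beta beta = coding.
Proof.
have [uA u0 up us] := @xgetPex _ (fun=> 0) (is_u_beta beta)
  (ex_intro _ _ is_u_beta_coding).
have [_ c0 cp cs] := is_u_beta_coding.
have [r0 _ _ _] := r_betaP beta_gt1 hY (V'_beta0 beta).
have big (m : nat) := exprn_double_unbounded m%:R beta_gt1 r0.
apply: (@bi_infinite_unique _ _ _ (fun n => iter n psi [:: hat 0])) => //.
- exact: etrans u0 (esym c0).
- move=> m; have [n [hn _]] := big m; exists n.
  have [/coded_size h _] := coded_iter_psi beta_gt1 hY n.
  by rewrite -(ltr_nat R); move: h; rewrite subr0; exact: lt_le_trans.
- move=> m; have [n [_ hn]] := big m; exists n.
  have [_ /coded_size h] := coded_iter_psi beta_gt1 hY n.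
  by rewrite -(ltr_nat R); move: h; rewrite sub0r mulNr opprK; exact: lt_le_trans.
Qed.

End Enumeration.

(** * Finiteness and unique decoding of words, and searches among the integers *)

Lemma finite_words (T : eqType) (A : set T) n : finite_set A ->
  finite_set [set w | word_over A w /\ (size w <= n)%N].
Proof.
move=> finA; elim: n => [|n IH].
  apply: (@sub_finite_set _ _ [set [::]]); last exact: finite_set1.
  by move=> [|a w] [].
apply: (@sub_finite_set _ _ ([set [::]] `|`
    [set a :: w | a in A & w in [set w | word_over A w /\ (size w <= n)%N]])).
  move=> [|a w] [wA sw]; [by left|right].
  exists a; first by apply: wA; rewrite mem_head.
  by exists w => //; split=> // b bw; apply: wA; rewrite inE bw orbT.
by rewrite finite_setU; split; [exact: finite_set1|exact: finite_image2].
Qed.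

(** Each occurrence of [x] marks the beginning of a word, so the boundaries can be read off the
    concatenation. *)
Lemma flatten_code_inj (T : eqType) (x : T) (ws ws' : seq (seq T)) :
  (forall w, w \in ws -> exists2 t, w = x :: t & x \notin t) ->
  (forall w, w \in ws' -> exists2 t, w = x :: t & x \notin t) ->
  flatten ws = flatten ws' -> ws = ws'.
Proof.
have index_tail t us : x \notin t ->
    (forall w, w \in us -> exists2 t, w = x :: t & x \notin t) ->
    index x (t ++ flatten us) = size t.
  move=> xt h; rewrite index_cat (negbTE xt); case: us h => [|u us] h /=.
    exact: addn0.
  by have [t' -> _] := h u (mem_head _ _); rewrite /= eqxx addn0.
elim: ws ws' => [|w ws IH] [|w' ws'] //= h h'.
- by have [t -> _] := h' w' (mem_head _ _).
- by have [t -> _] := h w (mem_head _ _).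
have hs v : v \in ws -> exists2 t, v = x :: t & x \notin t.
  by move=> vws; apply: h; rewrite inE vws orbT.
have hs' v : v \in ws' -> exists2 t, v = x :: t & x \notin t.
  by move=> vws; apply: h'; rewrite inE vws orbT.
have [t -> xt] := h w (mem_head _ _); have [t' -> xt'] := h' w' (mem_head _ _).
move=> [e]; have st : size t = size t'.
  by rewrite -(index_tail t ws xt hs) e index_tail.
move/eqP: e; rewrite eqseq_cat // => /andP[/eqP -> /eqP e].
by rewrite (IH ws').
Qed.

Lemma int_least (Q : int -> Prop) k j : k < j -> Q j ->
  exists m, [/\ k < m, Q m & forall i, k < i < m -> ~ Q i].
Proof.
move=> kj Qj; have ex : exists n : nat, `[< Q (k + n.+1%:Z) >].
  by exists (absz (j - k)%R).-1; rewrite (_ : k + _ = j); [exact/asboolP|lia].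
case: (ex_minnP ex) => n /asboolP Qn nmin; exists (k + n.+1%:Z); split=> //.
  lia.
move=> i /andP[ki im] Qi.
have : (n <= (absz (i - k)%R).-1)%N.
  by apply: nmin; apply/asboolP; rewrite (_ : k + _ = i) //; lia.
lia.
Qed.

Lemma int_greatest (Q : int -> Prop) k j : j < k -> Q j ->
  exists m, [/\ m < k, Q m & forall i, m < i < k -> ~ Q i].
Proof.
move=> jk Qj.
have [||m [mk Qm h]] := @int_least (fun i => Q (- i)) (- k) (- j).
- by rewrite ltrN2.
- by rewrite opprK.
exists (- m); split=> //; first by lia.
by move=> i im; have := h (- i); rewrite opprK; apply; lia.
Qed.

(** An integer-valued increasing sequence gains at least 1 per step. *)
Lemma int_increasing_cofinal (f : int -> int) :
  (forall j, f j < f (j + 1)) -> forall k, exists j, f j <= k < f (j + 1).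
Proof.
move=> f_incr k; apply: int_increasing_between.
have up (n : nat) : f 0 + n%:Z <= f n%:Z.
  elim: n => [|n IH]; first by rewrite addr0.
  by have := f_incr n%:Z; rewrite (_ : n%:Z + 1 = n.+1%:Z); lia.
have down (n : nat) : f (- n%:Z) <= f 0 - n%:Z.
  elim: n => [|n IH]; first by rewrite subr0.
  by have := f_incr (- n.+1%:Z); rewrite (_ : - n.+1%:Z + 1 = - n%:Z); lia.
exists (absz (k - f 0)%R).+1.
have := up (absz (k - f 0)%R).+1; have := down (absz (k - f 0)%R).+1; lia.
Qed.

(** * Zeros of [tau] and return words *)

Section ReturnWords.
Context {R : realType}.
Variable beta : R.
Hypothesis beta_gt1 : 1 < beta.
Hypothesis hY : Yrrap beta.

Local Notation T := (T_beta beta).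
Local Notation V' := (V'_beta beta).
Local Notation r := (r_beta beta).
Local Notation hat := (hat beta).
Local Notation psi := (psi_beta beta).
Local Notation phi := (phi_beta beta).
Local Notation tau := (tau beta).
Local Notation gap := (gap beta).
Local Notation coded := (coded beta).

(** Density gives an exponent for each of the finitely many [x]; their maximum works for all, since
    [T] fixes 0. *)
Lemma uniform_zero_dense : beta + 1 <= beta ^+ 2 -> exists N, forall x, V' x ->
  exists2 q, x < q < r x & iter N T q = 0.
Proof.
move=> beta_golden.
have [s Vs] := (finite_seqP _).1 (finite_V'_beta hY).
have /choice[f fP] x : exists n, V' x -> exists2 q, x < q < r x & iter n T q = 0.
  have [Vx|nV] := pselect (V' x); last by exists 0%N.
  have [xr _ rr _] := r_betaP beta_gt1 hY Vx.
  have /andP[lx _] := V'_beta_itv beta_gt1 Vx.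
  have [n [q [h1 h2]]] := zero_dense beta_gt1 beta_golden lx xr rr.
  by exists n; exists q.
exists (\max_(x <- s) f x) => x Vx; have [q xq Tq] := fP x Vx.
exists q => //; have fx : (f x <= \max_(x <- s) f x)%N.
  by apply: leq_bigmax_seq => //; move: Vx; rewrite Vs.
by rewrite -(subnK fx) iterD Tq iter_T_beta0.
Qed.

Variables z e : int -> R.
Hypothesis z0 : z 0 = 0.
Hypothesis zgap : forall k, gap (e k) (z k) (z (k + 1)).

Local Notation u := (coding beta z e).
Local Notation zlt := (int_increasing_lt (chain_incr beta_gt1 hY zgap)).
Local Notation zle := (int_increasing_le (chain_incr beta_gt1 hY zgap)).
Local Notation zinj := (int_increasing_inj (chain_incr beta_gt1 hY zgap)).

Let beta_gt0 : 0 < beta. Proof. exact: lt_trans ltr01 beta_gt1. Qed.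

Lemma zero_index p : tau p = 0 -> exists k, p = z k.
Proof.
move=> tp; apply: (chain_surj beta_gt1 hY z0 zgap).
by rewrite tp; exact: V'_beta0.
Qed.

(** After division by [B], a whole gap lies within distance 2 to the right of p / B. It contains a
    point whose type reaches 0 under [N] steps of [T]; multiplying it by [B] gives the zero. *)
Lemma zero_gap_bounded : beta + 1 <= beta ^+ 2 ->
  exists2 C, 0 < C & forall p, exists k,
  tau (z k) = 0 /\ p < z k <= p + C.
Proof.
move=> /uniform_zero_dense[N hN].
(* The exponent is doubled so that (- beta)^(2N) is positive and preserves order. *)
pose B := beta ^+ N.*2.
have B0 : 0 < B by rewrite exprn_gt0.
have BE : B = (- beta) ^+ N.*2 by rewrite exprNn -signr_odd odd_double mul1r.
exists (2 * B); first by rewrite mulr_gt0.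
move=> p; have [k /andP[k1 k2]] := int_increasing_between
  (chain_unbounded beta_gt1 hY z0 zgap (p / B)).
have g1 := gap_le1 beta_gt1 hY (zgap k).
have g2 := gap_le1 beta_gt1 hY (zgap (k + 1)).
have [Ve eE _ _ tE] := zgap (k + 1).
have [q /andP[eq qr] Tq] := hN _ Ve.
pose p0 := z (k + 1) + (q - e (k + 1)).
have p0q : tau p0 = q by rewrite tE /p0; lra.
have tz : tau (B * p0) = 0.
  by rewrite BE tau_iter // p0q -addnn iterD Tq iter_T_beta0.
have [i iE] := zero_index tz; exists i; rewrite -iE; split=> //.
move: k1 k2; rewrite ler_pdivlMr // ltr_pdivrMr // => k1 k2.
have : B * z (k + 1) < B * p0 by rewrite ltr_pM2l // /p0; lra.
have : B * p0 <= B * (z k + 2) by rewrite ler_pM2l // /p0; lra.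
lra.
Qed.

Definition next_zero (k j : int) :=
  [/\ k < j, tau (z j) = 0 & forall i, k < i < j -> tau (z i) <> 0].

Lemma zero_chain : beta + 1 <= beta ^+ 2 -> exists K : int -> int,
  K 0 = 0 /\ forall j, tau (z (K j)) = 0 /\ next_zero (K j) (K (j + 1)).
Proof.
move=> /zero_gap_bounded[C C0 hC].
apply: (@bi_infinite_chain _ [set k | tau (z k) = 0] next_zero 0) => [|k Dk|k Dk].
- by rewrite /= z0 tau0.
- have [j [Dj /andP[kj _]]] := hC (z k).
  rewrite zlt in kj.
  have [m [km Dm h]] := @int_least (fun i => tau (z i) = 0) _ _ kj Dj.
  by exists m.
(* The extra 1 places the zero found strictly to the left of [z k]. *)
- have [j [Dj /andP[_ jk]]] := hC (z k - C - 1).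
  have {}jk : z j < z k by lra.
  rewrite zlt in jk.
  have [m [mk Dm h]] := @int_greatest (fun i => tau (z i) = 0) _ _ jk Dj.
  by exists m.
Qed.

Variable K : int -> int.
Hypothesis K0 : K 0 = 0.
Hypothesis Kzero : forall j, tau (z (K j)) = 0.
Hypothesis Knext : forall j, next_zero (K j) (K (j + 1)).

Lemma K_incr j : K j < K (j + 1). Proof. by have [] := Knext j. Qed.

Lemma K_surj k : tau (z k) = 0 -> exists j, k = K j.
Proof.
move=> zk; have [j /andP[]] := int_increasing_cofinal K_incr k.
rewrite le_eqVlt => /orP[/eqP <- _|h1 h2]; first by exists j.
by have [_ _ h] := Knext j; case: (h k) => //; rewrite h1.
Qed.

Let uE : u_beta beta = u. Proof. exact: u_beta_coding. Qed.

(** The point [i] is included and the point [j] excluded, so consecutive words concatenate without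
    overlap. *)
Definition word_between (i j : int) := subword u (2 * i) (absz (2 * j - 2 * i)%R).

Lemma s_betaK j : s_beta beta (K j) = K (j + 1).
Proof.
have [h1 h2 h3] := Knext j.
rewrite /s_beta uE; apply: xget_unique.
  split; first by rewrite /= coding_even.
  move=> i [ki]; rewrite coding_even => zi; rewrite leNgt; apply/negP => ik.
  by apply: (h3 i) zi; rewrite ki.
move=> y [[ky]]; rewrite coding_even => zy lb; apply/eqP; rewrite eq_le.
rewrite lb ?leNgt /=; last by rewrite /= coding_even.
by apply/negP => yk; apply: (h3 y) zy; rewrite ky.
Qed.

Definition nth_return_word (j : int) := return_word beta (K j).

Lemma nth_return_wordE j : nth_return_word j = word_between (K j) (K (j + 1)).
Proof. by rewrite /nth_return_word /return_word s_betaK uE. Qed.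

Lemma word_between_cat i j k : i <= j -> j <= k ->
  word_between i j ++ word_between j k = word_between i k.
Proof.
move=> ij jk; rewrite /word_between.
rewrite (_ : absz (2 * k - 2 * i)%R =
  (absz (2 * j - 2 * i)%R + absz (2 * k - 2 * j)%R)%N); last by lia.
by rewrite subword_cat; congr (_ ++ subword _ _ _); lia.
Qed.

Lemma coded_chain i (n : nat) :
  coded (z i) (subword u (2 * i + 1) n.*2.+1) (z (i + n.+1%:Z)).
Proof.
elim: n i => [|n IH] i.
  by rewrite subwordS coding_odd; exact: (coded_gap (zgap i)).
rewrite doubleS (subwordS _ _ n.*2.+2) (subwordS _ _ n.*2.+1) coding_odd.
rewrite (_ : 2 * i + 1 + 1 = 2 * (i + 1)) ?coding_even; last by lia.
apply: coded_cons => //.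
by rewrite (_ : i + n.+2%:Z = i + 1 + n.+1%:Z); [exact: IH|lia].
Qed.

Lemma L_beta_coded a w b : coded a w b -> L_beta beta w = b - a.
Proof.
rewrite /L_beta; elim=> {a w b} [x a b [Vx -> _ _ _]|x a b w c [Vx h _ Vb _] _ IH].
  by rewrite big_seq1 letter_length_hat.
by rewrite !big_cons IH letter_length_hat // letter_length_point // -h; lra.
Qed.

Lemma word_betweenE i j : i < j -> tau (z i) = 0 -> exists w,
  word_between i j = 0 :: w /\ coded (z i) w (z j).
Proof.
move=> ij zi; have jE : j = i + (absz (j - i)%R).-1.+1%:Z by lia.
exists (subword u (2 * i + 1) (absz (j - i)%R).-1.*2.+1); split.
  rewrite /word_between.
  rewrite (_ : absz _ = (absz (j - i)%R).-1.*2.+2); last by lia.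
  by rewrite subwordS coding_even zi.
by rewrite [in z j]jE; exact: coded_chain.
Qed.

Lemma L_word_between i j : i < j -> tau (z i) = 0 ->
  L_beta beta (word_between i j) = z j - z i.
Proof.
move=> ij zi; have [w [-> cw]] := word_betweenE ij zi.
have L0 := letter_length_point beta_gt1 hY (V'_beta0 beta).
by rewrite /L_beta big_cons L0 add0r; exact: (L_beta_coded cw).
Qed.


Local Notation W := nth_return_word.

Lemma zeros_incr j : z (K j) < z (K (j + 1)).
Proof. by rewrite zlt K_incr. Qed.

Lemma R_betaE : R_beta beta = range W.
Proof.
rewrite /R_beta uE; apply/seteqP; split=> w [k].
  by rewrite /= coding_even => /K_surj[j ->] <-; exists j.
by move=> _ <-; exists (K k) => //=; rewrite coding_even.
Qed.

Lemma L_return_word j : L_beta beta (W j) = z (K (j + 1)) - z (K j).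
Proof. by rewrite nth_return_wordE L_word_between // K_incr. Qed.

(** Consecutive zeros are at distance at most [C] and gaps have length at least [d], so a return
    word has at most C / d gaps, with two letters for each. *)
Lemma finite_R_beta : beta + 1 <= beta ^+ 2 -> finite_set (R_beta beta).
Proof.
move=> /zero_gap_bounded[C C0 hC].
have [d d0 dP] := min_gap beta_gt1 hY.
have grow i (n : nat) : n%:R * d <= z (i + n%:Z) - z i.
  elim: n => [|n IH]; first by rewrite addr0 subrr mul0r.
  have := dP _ _ _ (zgap (i + n%:Z)).
  by rewrite -addrA (_ : n%:Z + 1 = n.+1%:Z) -?natr1; [lra|lia].
pose M := Num.trunc (C / d).
apply: (@sub_finite_set _ _
    [set w | word_over (A_beta beta) w /\ (size w <= M.*2)%N]); last first.
  apply: finite_words; rewrite /A_beta finite_setU.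
  by split; [|apply: finite_image]; exact: finite_V'_beta.
rewrite R_betaE => w [j _ <-]; rewrite nth_return_wordE /word_between; split.
  move=> a /mapP[k _ ->].
  by have [h _ _ _] := is_u_beta_coding beta_gt1 hY z0 zgap; exact: h.
rewrite size_subword.
have [i [zi /andP[i1 i2]]] := hC (z (K j)).
rewrite zlt in i1.
have ij : K (j + 1) <= i.
  have [_ _ h] := Knext j; rewrite leNgt; apply/negP => hi.
  by apply: (h i) zi; rewrite i1.
have := grow (K j) (absz (K (j + 1) - K j)%R).
have := K_incr j; set n := absz _ => kj.
rewrite (_ : K j + n%:Z = K (j + 1)); last by rewrite /n; lia.
move=> h; have : z (K (j + 1)) <= z i by rewrite zle.
move=> h'; have : n%:R <= C / d by rewrite ler_pdivlMr //; lra.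
move=> nC; have : (n <= M)%N.
  by rewrite truncn_ge_nat // divr_ge0 // ltW.
by rewrite /n; lia.
Qed.

Lemma flatten_return_words a (n : nat) :
  flatten (subword W a n) = word_between (K a) (K (a + n%:Z)).
Proof.
have Kle := int_increasing_le K_incr.
elim: n a => [|n IH] a; first by rewrite addr0 /word_between subrr.
rewrite subwordS /= IH nth_return_wordE word_between_cat.
- by congr word_between; congr K; lia.
- by rewrite Kle lerDl.
- by rewrite Kle lerDl.
Qed.

Lemma subword_return_over a n : word_over (R_beta beta) (subword W a n).
Proof. by move=> w /mapP[k _ ->]; rewrite R_betaE; exists (a + k%:Z). Qed.

(** Later letters are either hats, which are not in [V'], or types of points strictly between
    consecutive zeros. *)
Lemma return_word_head w : R_beta beta w -> exists2 t, w = 0 :: t & 0 \notin t.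
Proof.
rewrite R_betaE => -[j _ <-]; rewrite nth_return_wordE /word_between.
have kj := K_incr j.
rewrite (_ : absz _ = (absz (2 * K (j + 1) - 2 * K j)%R).-1.+1); last by lia.
rewrite subwordS coding_even Kzero; set n := _.-1.
exists (subword u (2 * K j + 1) n) => //.
apply/negP => /mapP[k]; rewrite mem_iota => /andP[_ kn].
have [m] : exists m : nat, k = m.*2 \/ k = m.*2.+1.
  by exists k./2; have := odd_double_half k; case: (odd k) => /=; lia.
case=> km.
  rewrite (_ : 2 * K j + 1 + k%:Z = 2 * (K j + m%:Z) + 1); last by lia.
  rewrite coding_odd => h0; have Ve := chain_e zgap (K j + m%:Z).
  by apply: (hat_notV' beta_gt1 hY Ve); rewrite -h0; exact: V'_beta0.
rewrite (_ : 2 * K j + 1 + k%:Z = 2 * (K j + m.+1%:Z)); last by lia.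
rewrite coding_even => h0; have [_ _ h] := Knext j.
apply: (h (K j + m.+1%:Z)) => //; lia.
Qed.

(** * [phi] as multiplication by - beta on runs of return words *)

Lemma psi_word_between i j i' j' : i < j -> tau (z i) = 0 -> tau (z j) = 0 ->
  z i' = - beta * z j -> z j' = - beta * z i ->
  psi (rcons (word_between i j) 0) = rcons (word_between i' j') 0.
Proof.
move=> ij zi zj ei ej; have [w [-> cw]] := word_betweenE ij zi.
have ij' : i' < j' by rewrite -zlt ei ej !mulNr ltrN2 ltr_pM2l // zlt.
have zi' : tau (z i') = 0 by rewrite ei tauM // zj T_beta0.
have [w' [-> cw']] := word_betweenE ij' zi'.
have cp := coded_psi beta_gt1 hY cw; rewrite -ei -ej in cp.
(* Both words code the interval from [z i'] to [z j'], and a coding is determined by its ends. *)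
have ww : antimorphism (psi_letter beta) w = w'.
  change (psi w = w').
  have [n [nE ->]] := coded_subword beta_gt1 hY zgap cp erefl.
  have [n' [nE' ->]] := coded_subword beta_gt1 hY zgap cw' erefl.
  move: nE'; rewrite nE => /zinj e'.
  by congr (subword _ _ _.*2.+1); lia.
have V0 := V'_beta0 beta.
rewrite -cats1 /psi_beta antimorphism_cat (antimorphism_cons _ 0 w) ww.
by rewrite /antimorphism /= cats0 psi_letter_point // T_beta0 // -cats1.
Qed.

Lemma zeros_mul j : exists i, z (K i) = - beta * z (K j).
Proof.
have t0 : tau (- beta * z (K j)) = 0 by rewrite tauM // Kzero T_beta0.
have [k kE] := zero_index t0.
have [|i iE] := @K_surj k; first by rewrite -kE.
by exists i; rewrite -iE.
Qed.

(** The zeros in the image interval cut its coding into return words; by [flatten_code_inj] no other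
    factorization exists, so [phi_letter] selects this one. *)
Lemma phi_letter_return c a n :
  z (K a) = - beta * z (K (c + 1)) -> z (K (a + n%:Z)) = - beta * z (K c) ->
  phi_letter beta (W c) = subword W a n.
Proof.
move=> ea en; apply: xget_unique.
  split; first exact: subword_return_over.
  rewrite flatten_return_words nth_return_wordE.
  by apply: psi_word_between => //; exact: K_incr.
move=> ws [wsR].
rewrite nth_return_wordE (psi_word_between _ _ _ ea en) //; last exact: K_incr.
rewrite -flatten_return_words => /rcons_inj[h].
apply: (@flatten_code_inj _ 0) => // w ww; apply: return_word_head.
  exact: wsR.
exact: subword_return_over ww.
Qed.

Lemma zeros_inj i j : z (K i) = z (K j) -> i = j.
Proof. by move=> /zinj /(int_increasing_inj K_incr). Qed.

Lemma zeros_le i j : (z (K i) <= z (K j)) = (i <= j).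
Proof. exact: (int_increasing_le zeros_incr). Qed.

Lemma zeros_lt i j : (z (K i) < z (K j)) = (i < j).
Proof. exact: (int_increasing_lt zeros_incr). Qed.

Lemma phi_subword a (n : nat) a' (n' : nat) :
  z (K a') = - beta * z (K (a + n%:Z)) ->
  z (K (a' + n'%:Z)) = - beta * z (K a) ->
  phi (subword W a n) = subword W a' n'.
Proof.
have b0 := beta_gt0.
elim: n a n' => [|n IH] a n' ea en.
  have : a' + n'%:Z = a' by apply: zeros_inj; rewrite en ea addr0.
  by case: n' {en} => // n'; lia.
(* The image of the zero separating the first return word from the rest; reversal makes the first
   word yield the last block. *)
have [m mE] := zeros_mul (a + 1).
have am : a' <= m.
  rewrite -zeros_le ea mE !mulNr lerN2 ler_pM2l // zeros_le.
  by lia.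
have mn : m <= a' + n'%:Z.
  rewrite -zeros_le en mE !mulNr lerN2 ler_pM2l // zeros_le.
  by lia.
rewrite subwordS /phi_beta antimorphism_cons.
rewrite (_ : n' = absz (m - a')%R + absz (a' + n'%:Z - m)%R)%N; last by lia.
rewrite subword_cat (_ : a' + (absz (m - a')%R)%:Z = m); last by lia.
congr (_ ++ _).
  rewrite -/(phi _); apply: IH; first by rewrite ea; congr (_ * z (K _)); lia.
  by rewrite -mE; congr (z (K _)); lia.
by apply: phi_letter_return => //; rewrite -en; congr (z (K _)); lia.
Qed.

Lemma phi_subword_step a n : exists a' n',
  [/\ phi (subword W a n) = subword W a' n',
      z (K a') = - beta * z (K (a + n%:Z)) &
      z (K (a' + n'%:Z)) = - beta * z (K a)].
Proof.
have [i iE] := zeros_mul (a + n%:Z); have [j jE] := zeros_mul a.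
have b0 := beta_gt0.
have ij : i <= j.
  by rewrite -zeros_le iE jE !mulNr lerN2 ler_pM2l // zeros_le lerDl.
have jE' : i + (absz (j - i)%R)%:Z = j by lia.
exists i, (absz (j - i)%R); split; rewrite ?jE' //.
by apply: phi_subword; rewrite ?jE'.
Qed.

(** * The word [u'], its partial sums and the distances *)

Lemma w_betaE : w_beta beta = W 0.
Proof. by rewrite /w_beta /nth_return_word K0. Qed.

Lemma iter_phi n : exists m m' : nat,
  [/\ iter n.*2 phi [:: w_beta beta] = subword W 0 m,
      z (K m%:Z) = beta ^+ n.*2 * z (K 1),
      iter n.*2.+1 phi [:: w_beta beta] = subword W (- m'%:Z) m' &
      z (K (- m'%:Z)) = - beta ^+ n.*2.+1 * z (K 1)].
Proof.
have zK0 : z (K 0) = 0 by rewrite K0.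
suff [m [h1 h2]] : exists m : nat, iter n.*2 phi [:: w_beta beta] = subword W 0 m /\
    z (K m%:Z) = beta ^+ n.*2 * z (K 1).
  have [a [m' [h3 h4 h5]]] := phi_subword_step 0 m.
  rewrite zK0 mulr0 -zK0 in h5; rewrite add0r in h4.
  (* The image of a run starting at the zero 0 ends there, which fixes its starting index. *)
  have am := zeros_inj h5; have aE : a = - m'%:Z by lia.
  exists m, m'; split=> //; first by rewrite iterS h1 h3 aE.
  by rewrite -aE h4 h2 mulrA mulNr -exprS.
elim: n => [|n [m [h1 h2]]].
  by exists 1%N; rewrite /= w_betaE expr0 mul1r.
have [a [m' [h3 h4 h5]]] := phi_subword_step 0 m.
have [b [m2 [h6 h7 h8]]] := phi_subword_step a m'.
rewrite h5 zK0 !mulr0 -zK0 in h7; have bE := zeros_inj h7.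
exists m2; rewrite doubleS !iterS h1 h3 h6 bE; split=> //.
by move: h8; rewrite bE h4 !add0r h2 !exprS !mulrA mulrNN.
Qed.

(** Positive indices are shifted by one, as no letter sits at index 0: the return word starting at
    the origin is the letter at 1, the one ending there is at - 1. *)
Definition coding' (k : int) : seq R :=
  match k with Posz 0 => [::] | Posz n.+1 => W n%:Z | Negz n => W (Negz n) end.

Lemma is_u'_beta_coding' : is_u'_beta beta coding'.
Proof.
split=> // [[[//|k]|k] _|n|n].
- by rewrite R_betaE; exists k.
- by rewrite R_betaE; exists (Negz k).
- have [m [_ [-> _ _ _]]] := iter_phi n.
  by rewrite /prefix_of_positive size_subword; apply: eq_map => k.
- have [_ [m [_ _ -> _]]] := iter_phi n.
  rewrite [in X in suffix_of_negative X](subword_suffix W m).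
  rewrite /suffix_of_negative size_rev size_map size_iota size_subword.
  by congr rev; apply: eq_map => k; rewrite -NegzE.
Qed.

Lemma coding'_unique u' : is_u'_beta beta u' -> coding' = u'.
Proof.
move=> [u0 _ up us]; have [c0 _ cp cs] := is_u'_beta_coding'.
have y1 : 0 < z (K 1) by have := zeros_incr 0; rewrite K0 z0.
have big (p : R) := exprn_double_unbounded p beta_gt1 y1.
apply: (@bi_infinite_unique _ _ _ (fun n => iter n phi [:: w_beta beta])) => //.
- move=> k; have [n [hn _]] := big (z (K k%:Z)); exists n.
  have [m [m' [-> hm _ _]]] := iter_phi n.
  by rewrite size_subword; move: hn; rewrite -hm zeros_lt ltz_nat.
- move=> k; have [n [_ hn]] := big (- z (K (- k%:Z))); exists n.
  have [m [m' [_ _ -> hm]]] := iter_phi n.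
  rewrite size_subword; move: hn.
  by rewrite ltrNl -mulNr -hm zeros_lt ltrN2 ltz_nat.
Qed.

(** The lengths of return words are differences of consecutive zeros, so the sums telescope from the
    zero at the origin. *)
Lemma z'_betaE k : z'_beta beta coding' k = z (K k).
Proof.
have zK0 : z (K 0) = 0 by rewrite K0.
case: k => n; rewrite /z'_beta /=.
  elim: n => [|n IH]; first by rewrite big_geq.
  rewrite big_nat_recr //= IH L_return_word.
  by rewrite (_ : n%:Z + 1 = n.+1%:Z) ?subrKC //; lia.
rewrite -[RHS]opprK; congr (- _).
elim: n => [|n IH].
  rewrite big_nat1 (_ : - 1%:Z = Negz 0) //= L_return_word.
  by rewrite (_ : Negz 0 + 1 = 0) // zK0 sub0r.
rewrite big_nat_recr //= IH L_return_word.
by rewrite (_ : Negz n.+1 + 1 = Negz n); [lra|lia].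
Qed.

Lemma minus_beta_integers_zeros :
  minus_beta_integers beta = range (fun j => z (K j)).
Proof.
rewrite minus_beta_integersE //; apply/seteqP; split=> [p /= tp|_ [j _ <-]].
  have [k kE] := zero_index tp; have [|j jE] := @K_surj k; first by rewrite -kE.
  by exists j => //; rewrite -jE.
exact: Kzero.
Qed.

Lemma consecutive_distances_zeros :
  consecutive_distances (minus_beta_integers beta) =
  range (fun j => z (K (j + 1)) - z (K j)).
Proof.
rewrite minus_beta_integers_zeros; apply/seteqP; split=> [d|_ [j _ <-]].
  move=> [p [q [[i _ <-] [j _ <-] ij nz ->]]]; exists i => //.
  rewrite zeros_lt in ij.
  suff -> : j = i + 1 by [].
  have := nz _ (ex_intro2 _ _ (i + 1) I erefl).
  rewrite !zeros_lt => h; apply/eqP; rewrite eq_le; apply/andP; split; last by lia.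
  by rewrite leNgt; apply/negP => h'; apply: h; rewrite h'; lia.
exists (z (K j)), (z (K (j + 1))); split=> //; first exact: zeros_incr.
by move=> _ [i _ <-]; rewrite !zeros_lt; lia.
Qed.

End ReturnWords.

(** * The golden ratio bound and the conclusion *)

Lemma golden_le_sqr (R : realType) (beta : R) :
  (1 + Num.sqrt 5) / 2 <= beta -> 1 < beta /\ beta + 1 <= beta ^+ 2.
Proof.
have s0 : 0 <= Num.sqrt 5 :> R := sqrtr_ge0 _.
have s5 : Num.sqrt 5 ^+ 2 = 5 :> R by rewrite sqr_sqrtr.
(* The second claim amounts to (2 * beta - 1)^2 >= 5; the bound 2 gives beta >= 3 / 2 for the
   first. *)
move=> h; have s2 : 2 <= Num.sqrt 5 :> R by nra.
split; nra.
Qed.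

Unset Implicit Arguments.

Theorem theorem3p7 (R : realType) (beta : R)
    (hbeta : (1 + Num.sqrt 5) / 2 <= beta) (hY : Yrrap beta) :
  finite_set (R_beta beta) /\
  exists u' : int -> seq R,
    [/\ unique (is_u'_beta beta) u',
        minus_beta_integers beta = range (z'_beta beta u'),
        consecutive_distances (minus_beta_integers beta) =
          range (fun k : int => z'_beta beta u' (k + 1) - z'_beta beta u' k) &
        range (fun k : int => z'_beta beta u' (k + 1) - z'_beta beta u' k) =
          [set L_beta beta w | w in R_beta beta]].
Proof.
have [b1 bg] := golden_le_sqr hbeta.
have [z [e [z0 zgap]]] := gap_chain b1 hY.
have [K [K0 KP]] := zero_chain b1 hY z0 zgap bg.
have Kzero j := (KP j).1; have Knext j := (KP j).2.
have distE : (fun k : int => z'_beta beta (coding' beta K) (k + 1) -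
    z'_beta beta (coding' beta K) k) = fun k => z (K (k + 1)) - z (K k).
  by apply/funext => k; rewrite !(z'_betaE b1 hY z0 zgap K0 Kzero Knext).
split; first exact: (finite_R_beta b1 hY z0 zgap K0 Kzero Knext bg).
exists (coding' beta K); rewrite distE; split.
- split; first exact: (is_u'_beta_coding' b1 hY z0 zgap K0 Kzero Knext).
  exact: (coding'_unique b1 hY z0 zgap K0 Kzero Knext).
- rewrite (minus_beta_integers_zeros b1 hY z0 zgap Kzero Knext).
  apply: eq_imagel => k _.
  by rewrite (z'_betaE b1 hY z0 zgap K0 Kzero Knext).
- exact: (consecutive_distances_zeros b1 hY z0 zgap K0 Kzero Knext).
- rewrite (R_betaE b1 hY z0 zgap Kzero Knext) image_comp.
  apply: eq_imagel => j _ /=.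
  by rewrite (L_return_word b1 hY z0 zgap K0 Kzero Knext).
Qed.
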